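(* Let $d\ge2$, let $Y_1,\ldots,Y_n$ be (possibly dependent) random vectors in $\mathbb{R}^d$ that are almost surely in type $B$ general position, and let $\mathcal{D}_n^B$ be the Weyl random cone of type $B_n$ in $\mathbb{R}^d$. Then, for all $1\le j\le k\le d$, $$\mathbb{E}\, Y_{d-k+j,\,d-k}(\mathcal{D}_n^B)=\frac{2^{k-j}\binom{n}{k-j}D^B(n-k+j,j)}{2D^B(n,d)}\cdot\frac{n!}{(n-k+j)!}.$$
   Context: Type $B$ general position: vectors $y_1,\ldots,y_n\in\mathbb{R}^d$ are said to be in type $B$ general position if $n\ge d$ and, for every $\varepsilon=(\varepsilon_1,\ldots,\varepsilon_n)\in\{\pm1\}^n$ and every permutation $\sigma$ of $\{1,\ldots,n\}$, any $d$ of the vectors $\varepsilon_1y_{\sigma(1)}-\varepsilon_2y_{\sigma(2)},\ldots,\varepsilon_{n-1}y_{\sigma(n-1)}-\varepsilon_ny_{\sigma(n)},\,\varepsilon_ny_{\sigma(n)}$ are linearly independent. For $x\in\mathbb{R}^d\setminus\{0\}$ let $x^\perp=\{v\in\mathbb{R}^d:\langle v,x\rangle=0\}$. The Weyl tessellation $\mathcal{W}^B(y_1,\ldots,y_n)$ of type $B_n$ is the set of cones obtained as closures of the connected components of the complement in $\mathbb{R}^d$ of the union of the hyperplanes $(y_i+y_j)^\perp$ and $(y_i-y_j)^\perp$ for $1\le i<j\le n$, and $y_i^\perp$ for $1\le i\le n$. The Weyl random cone $\mathcal{D}_n^B$ is obtained by choosing uniformly at random one of the cones of the random tessellation $\mathcal{W}^B(Y_1,\ldots,Y_n)$;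 that is, for a functional $\varphi$ of cones, $\mathbb{E}\varphi(\mathcal{D}_n^B)=\mathbb{E}\big[\frac{1}{\#\mathcal{W}^B(Y_1,\ldots,Y_n)}\sum_{C\in\mathcal{W}^B(Y_1,\ldots,Y_n)}\varphi(C)\big]$. For a polyhedral cone $C\subset\mathbb{R}^d$, $\mathcal{F}_k(C)$ is the set of its $k$-dimensional faces, where faces are obtained by replacing some (possibly none) of the half-spaces defining $C$ by their boundaries. For a cone $C\subseteq\mathbb{R}^d$ that is not a linear subspace (the only case that occurs here) the conical quermassintegrals are $$U_j(C)=\frac12\int_{G(d,d-j)}\mathbf{1}\{C\cap L\ne\{0\}\}\,\nu_{d-j}(\mathrm{d}L),\quad j=0,\ldots,d,$$ where $G(d,m)$ is the Grassmannian of $m$-dimensional linear subspaces of $\mathbb{R}^d$ and $\nu_m$ is the unique rotation-invariant Borel probability measure on it. The size functionals (not to be confused with the random vectors $Y_i$) are $Y_{k,j}(C):=\sum_{F\in\mathcal{F}_k(C)}U_j(F)$ for $0\le j<k\le d$. The numbers $B[n,k]$ are defined by $(t+1)(t+3)\cdots(t+2n-1)=\sum_{k=0}^nB[n,k]\,t^k$, with $B[n,k]=0$ for $k\notin\{0,\ldots,n\}$, and $D^B(m,k):=2\sum_{i\ge 0}B[m,m-k+1+2i]$. *)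

(* Defs.v *)
From HB Require Import structures.
From mathcomp Require Import all_boot all_order all_algebra.
From mathcomp Require Import perm finmap.
From mathcomp Require Import all_classical all_reals all_analysis.
Set Implicit Arguments.
Unset Strict Implicit.
Unset Printing Implicit Defensive.
Import Order.TTheory GRing.Theory Num.Theory.
Import numFieldNormedType.Exports.
Local Open Scope classical_set_scope.
Local Open Scope ring_scope.

(* Vectors of R^d are row vectors 'rV[R]_d, on which matrices act from the
   right; subspaces are elements of {vspace 'rV[R]_d}. *)

Definition dotp (R : realType) (d : nat) (u v : 'rV[R]_d) : R :=
  \sum_(i < d) u 0 i * v 0 i.

Definition perp (R : realType) (d : nat) (x : 'rV[R]_d) : set 'rV[R]_d :=
  [set v | dotp v x = 0].

(* The sign eps_i is (-1) ^+ e i.  The last vector of the family has no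
   successor to subtract. *)
Definition signed_diff (R : realType) (d n : nat) (y : 'I_n -> 'rV[R]_d)
    (e : 'I_n -> bool) (s : 'S_n) (i : 'I_n) : 'rV[R]_d :=
  let w j := (-1) ^+ e j *: y (s j) in
  if insub i.+1 is Some j then w i - w j else w i.

Definition typeB_general_position (R : realType) (d n : nat)
    (y : 'I_n -> 'rV[R]_d) : Prop :=
  (d <= n)%N /\
  forall (e : 'I_n -> bool) (s : 'S_n) (A : {set 'I_n}),
    #|A| = d -> free [seq signed_diff y e s i | i in A].

Definition weyl_arrangement (R : realType) (d n : nat)
    (y : 'I_n -> 'rV[R]_d) : set 'rV[R]_d :=
  \bigcup_(p in [set p : 'I_n * 'I_n | (p.1 < p.2)%N])
    (perp (y p.1 + y p.2) `|` perp (y p.1 - y p.2))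
  `|` \bigcup_(i in [set: 'I_n]) perp (y i).

Definition weyl_tessellation (R : realType) (d n : nat)
    (y : 'I_n -> 'rV[R]_d) : set (set 'rV[R]_d) :=
  [set closure (connected_component (~` weyl_arrangement y) x)
    | x in ~` weyl_arrangement y].

(* Random vectors are random variables with values in R^d endowed with its
   Borel sigma-algebra. *)
Definition borel_rV (R : realType) (d : nat) :=
  g_sigma_algebraType (@open 'rV[R]_d).
HB.instance Definition _ (R : realType) (d : nat) :=
  Measurable.on (borel_rV R d).

(* E phi(D) where, given the random vectors Y, the cone D is uniform on the
   (finite) set weyl_tessellation Y. *)
Definition weyl_cone_expectation (R : realType) (disp : measure_display)
    (T : measurableType disp) (P : probability T R) (d n : nat)
    (Y : 'I_n -> {RV P >-> borel_rV R d}) (phi : set 'rV[R]_d -> R) : \bar R :=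
  let W w := weyl_tessellation (fun i => Y i w : 'rV[R]_d) in
  ('E_P[fun w => ((#|` fset_set (W w)|%:R)^-1 * \sum_(C \in W w) phi C)%R])%E.

(* A face of C arises from some representation of C as a finite intersection
   of closed half-spaces with normals x i, those with index in S being
   replaced by their bounding hyperplanes.  For a polyhedral cone the
   resulting set of faces is the same for all representations. *)
Definition is_face (R : realType) (d : nat) (C F : set 'rV[R]_d) : Prop :=
  exists (m : nat) (x : 'I_m -> 'rV[R]_d) (S : {set 'I_m}),
    [/\ forall i, x i != 0,
        C = [set v | forall i, 0 <= dotp v (x i)] &
        F = [set v | forall i,
               if i \in S then dotp v (x i) = 0 else 0 <= dotp v (x i)]].

(* The dimension of a cone is that of its linear hull. *)
Definition has_dim (R : realType) (d : nat) (F : set 'rV[R]_d) (k : nat) :=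
  exists V : {vspace 'rV[R]_d},
    [/\ \dim V = k, F `<=` [set` V] &
        forall V' : {vspace 'rV[R]_d}, F `<=` [set` V'] -> (V <= V')%VS].

Definition faces (R : realType) (d k : nat) (C : set 'rV[R]_d) :
    set (set 'rV[R]_d) :=
  [set F | is_face C F /\ has_dim F k].

(* Indexing by m : 'I_d.+1 (that is, 0 <= m <= d) keeps G(d,m) nonempty. *)
Definition grass (R : realType) (d : nat) (m : 'I_d.+1) :=
  {L : {vspace 'rV[R]_d} | \dim L == m}.
HB.instance Definition _ (R : realType) (d : nat) (m : 'I_d.+1) :=
  Choice.on (grass R m).

Lemma grass_point_subproof (R : realType) (d : nat) (m : 'I_d.+1) :
  \dim <<take m (vbasis (fullv : {vspace 'rV[R]_d}))>>%VS == m.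
Proof.
have fb := basis_free (vbasisP (fullv : {vspace 'rV[R]_d})).
rewrite -[X in free X](cat_take_drop m) in fb.
have /eqP -> := catl_free fb.
by rewrite size_takel // size_tuple dimvf /dim /= mul1n -ltnS ltn_ord.
Qed.

HB.instance Definition _ (R : realType) (d : nat) (m : 'I_d.+1) :=
  isPointed.Build (grass R m)
    (exist (fun L : {vspace 'rV[R]_d} => \dim L == m)
       _ (grass_point_subproof R m)).

(* The usual topology of G(d,m), i.e. the quotient topology along the map
   that sends an m-frame (the rows of an m x d matrix of rank m) to its span.
   Frames form an open subset of all m x d matrices. *)
Definition grass_open (R : realType) (d : nat) (m : 'I_d.+1)
    (U : set (grass R m)) : Prop :=
  open [set B : 'M[R]_(m, d) |
    exists2 L, U L & val L = <<[seq row i B | i : 'I_m]>>%VS].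

Definition borel_grass (R : realType) (d : nat) (m : 'I_d.+1) :=
  g_sigma_algebraType (@grass_open R d m).
HB.instance Definition _ (R : realType) (d : nat) (m : 'I_d.+1) :=
  Measurable.on (borel_grass R m).

Definition is_rotation (R : realType) (d : nat) (Q : 'M[R]_d) : Prop :=
  Q *m Q^T = 1%:M /\ \det Q = 1.

Definition rotate_set (R : realType) (d : nat) (m : 'I_d.+1) (Q : 'M[R]_d)
    (A : set (borel_grass R m)) : set (borel_grass R m) :=
  [set L' | exists2 L, A L & val L' = (linfun (mulmxr Q) @: val L)%VS].

Definition rotation_invariant (R : realType) (d : nat) (m : 'I_d.+1)
    (nu : probability (borel_grass R m) R) : Prop :=
  forall (Q : 'M[R]_d) (A : set (borel_grass R m)),
    is_rotation Q -> measurable A -> nu (rotate_set Q A) = nu A.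

(* nu m is the invariant measure on G(d,m); inord (d - j) is d - j seen as an
   element of 'I_d.+1.  This formula is meant for cones other than linear
   subspaces. *)
Definition quermass (R : realType) (d : nat)
    (nu : forall m : 'I_d.+1, probability (borel_grass R m) R)
    (j : nat) (C : set 'rV[R]_d) : R :=
  2^-1 * \int[nu (inord (d - j))]_(L in setT)
    \1_[set L : borel_grass R (inord (d - j)) |
        C `&` [set` val L] <> [set 0]] L.

Definition size_functional (R : realType) (d : nat)
    (nu : forall m : 'I_d.+1, probability (borel_grass R m) R)
    (k j : nat) (C : set 'rV[R]_d) : R :=
  \sum_(F \in faces k C) quermass nu j F.

Definition Bnum (n : nat) (k : int) : int :=
  if k is Posz k' then (\prod_(i < n) ('X + (2 * i + 1)%N%:R%:P) : {poly int})`_k'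
  else 0.

(* The series over i >= 0 is cut at i < k: for i >= k one has
   m - k + 1 + 2 i > m, so the terms left out vanish. *)
Definition DB (m k : nat) : int :=
  2 * \sum_(i < k) Bnum m (m%:Z - k%:Z + 1 + 2 * i%:Z).

(* Main.v *)
Require Import Defs.
From mathcomp Require Import all_boot all_order all_algebra.
From mathcomp Require Import perm finmap.
From mathcomp Require Import all_classical all_reals all_analysis.
From mathcomp Require Import measurable_realfun ring lra zify.
Import Order.TTheory GRing.Theory Num.Theory.
Import numFieldNormedType.Exports.
Local Open Scope classical_set_scope.
Local Open Scope ring_scope.
Set Implicit Arguments.
Unset Strict Implicit.
Unset Printing Implicit Defensive.

(** Write x_i for the linear form of y_i.  The chambers of the arrangement are
    the nonempty sets e_1 x_(s 1) > ... > e_n x_(s n) > 0 given by signed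
    permutations, and turning r of the n inequalities into equations gives the
    faces of codimension r.  Hence a pair of a cone of the tessellation and one
    of its faces is a word: a signed permutation with r marked ties, whose
    system of equations and inequalities is solvable ([tessellationE],
    [facesE], [sum_faces]).  If L is a k-dimensional subspace in general
    position, the face meets L beyond 0 exactly when the system of the word is
    solvable in L ([face_hits]).  So, up to the factor 1/2, the sum of the
    quermassintegrals of the faces is the integral over L of the number of
    words that are solvable in L.  This number turns out to depend on n, k and
    r only, and the average over the tessellation is deterministic.

    For r = 0 the number follows from deletion and restriction
    ([chamber_step]).  Adding a vector y_i to n - 1 others adds the 2 n - 1
    hyperplanes x_i = x_j, x_i = - x_j and x_i = 0.  A chamber is an open
    convex cone on which the values of the other letters are ordered, so the
    new hyperplanes cut it into one more piece than the number of those that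
    meet it.  On every new hyperplane the arrangement restricts to that of the
    n - 1 vectors.  This gives N (n, k) = N (n - 1, k) + (2 n - 1) N (n - 1,
    k - 1), the recursion of the numbers D^B (n, k) ([chamber_count]).  For
    r > 0, removing a tied letter and cutting L by the equation of the tie
    shows that r times the number for (n, k, r) is 2 n^2 times the number for
    (n - 1, k - 1, r - 1) ([face_step], [face_count_formula]).  Subspaces are
    described by lists of normals, so that cutting only adds a normal.

    Almost every L is in general position.  For one subspace V this is shown
    from rotation invariance ([nu_special]): V is a hyperplane of some W, and
    it has infinitely many rotated copies in W, orthogonal to the points of a
    moment curve, such that each L generic for W is exceptional for a bounded
    number of copies only.  The exceptional sets and the sets of subspaces
    that meet a closed cone are measurable because their complements are open
    in terms of frames.

    The combinatorial cones have to be identified with the closures of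
    connected components ([component_chamber], [closure_chamber]), and the
    faces taken from an arbitrary representation by half-spaces with those of
    the words ([is_face_closed_face]). *)

(** * Dot product *)

Section Dot.
Variables (R : realType) (d : nat).
Implicit Types u v w : 'rV[R]_d.

Lemma dotpC u v : dotp u v = dotp v u.
Proof. by apply: eq_bigr => i _; rewrite mulrC. Qed.

Lemma dotpDl u v w : dotp (u + v) w = dotp u w + dotp v w.
Proof. by rewrite -big_split; apply: eq_bigr => i _; rewrite mxE mulrDl. Qed.

Lemma dotpZl a u w : dotp (a *: u) w = a * dotp u w.
Proof. by rewrite mulr_sumr; apply: eq_bigr => i _; rewrite mxE mulrA. Qed.

Lemma dotpDr u v w : dotp u (v + w) = dotp u v + dotp u w.
Proof. by rewrite dotpC dotpDl !(dotpC u). Qed.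

Lemma dotpZr a u w : dotp u (a *: w) = a * dotp u w.
Proof. by rewrite dotpC dotpZl dotpC. Qed.

Lemma dotp0l u : dotp 0 u = 0.
Proof. by rewrite -(scale0r 0) dotpZl mul0r. Qed.

Lemma dotp0r u : dotp u 0 = 0.
Proof. by rewrite dotpC dotp0l. Qed.

Lemma dotpNl u v : dotp (- u) v = - dotp u v.
Proof. by rewrite -scaleN1r dotpZl mulN1r. Qed.

Lemma dotpNr u v : dotp u (- v) = - dotp u v.
Proof. by rewrite dotpC dotpNl dotpC. Qed.

Lemma dotpBl u v w : dotp (u - v) w = dotp u w - dotp v w.
Proof. by rewrite dotpDl dotpNl. Qed.

Lemma dotpBr u v w : dotp u (v - w) = dotp u v - dotp u w.
Proof. by rewrite dotpDr dotpNr. Qed.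

Lemma dotp_sumr (J : Type) (r : seq J) (Q : pred J) (f : J -> 'rV[R]_d) u :
  dotp u (\sum_(i <- r | Q i) f i) = \sum_(i <- r | Q i) dotp u (f i).
Proof.
by elim/big_rec2: _ => [|i a b _ <-]; rewrite ?dotp0r ?dotpDr.
Qed.

Lemma dotp_ge0 u : 0 <= dotp u u.
Proof. by apply: sumr_ge0 => i _; rewrite -expr2 sqr_ge0. Qed.

Lemma dotp_eq0 u : (dotp u u == 0) = (u == 0).
Proof.
apply/eqP/eqP => [|->]; last by rewrite dotp0l.
move=> /eqP; rewrite psumr_eq0 => [/allP h|i _]; last by rewrite -expr2 sqr_ge0.
apply/rowP => i; rewrite mxE; have := h i (mem_index_enum _).
by rewrite /= mulf_eq0 orbb => /eqP.
Qed.

Lemma dotp_delta v i : dotp v (delta_mx 0 i) = v 0 i.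
Proof.
rewrite /dotp (bigD1 i) //= mxE !eqxx mulr1 big1 ?addr0 // => k ki.
by rewrite mxE (negPf ki) andbF mulr0.
Qed.

(** The coordinate forms of a free family extend to linear forms on the whole
    space, and these are dot products. *)
Lemma free_dual (s : seq 'rV[R]_d) : free s ->
  forall c : nat -> R, exists v, forall i, (i < size s)%N -> dotp v s`_i = c i.
Proof.
move=> fs c.
pose X := in_tuple s.
pose f (x : 'rV[R]_d) := \sum_(i < size s) c i * coord X i x.
exists (\row_j f (delta_mx 0 j)) => i lis.
have fE x : dotp (\row_j f (delta_mx 0 j)) x = f x.
  rewrite /dotp; under eq_bigr => j _ do rewrite mxE mulr_suml.
  rewrite exchange_big; apply: eq_bigr => k _ /=.
  rewrite [x in RHS]row_sum_delta linear_sum mulr_sumr.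
  by apply: eq_bigr => j _; rewrite linearZ mulrCA mulrC mulrA.
rewrite fE /f (bigD1 (Ordinal lis)) //= -[s`_i]/(X`_(Ordinal lis)) big1 => [|k ki].
  by rewrite coord_free // eqxx mulr1 addr0.
by rewrite coord_free // eq_sym (negPf ki) mulr0.
Qed.

Lemma free_dual_in (s : seq 'rV[R]_d) (c : 'rV[R]_d -> R) : free s ->
  exists v, forall x, x \in s -> dotp v x = c x.
Proof.
move=> fs; have [v hv] := free_dual fs (fun i => c s`_i).
by exists v => x /(nthP 0) [i lis <-]; exact: hv.
Qed.

End Dot.

(** * Inserting an entry into a word *)

Section Insertion.
Variable A : Type.
Implicit Types (a : A) (u : seq A).

Definition ins p a u := take p u ++ a :: drop p u.

Lemma size_ins p a u : size (ins p a u) = (size u).+1.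
Proof. by rewrite /ins size_cat /= addnS -size_cat cat_take_drop. Qed.

Lemma ins0 a u : ins 0 a u = a :: u.
Proof. by rewrite /ins take0 drop0. Qed.

End Insertion.

Arguments ins : simpl never.

Section InsertSum.
Variable A : finType.
Local Open Scope nat_scope.

Lemma ins_tupleP n p a (u : n.-tuple A) : size (ins p a u) == n.+1.
Proof. by rewrite size_ins size_tuple. Qed.
Canonical ins_tuple n p a (u : n.-tuple A) := Tuple (ins_tupleP p a u).

(** Insertion at position p is a bijection; its inverse splits off the entry
    in position p. *)
Lemma sum_ins n p (Q : pred (seq A)) (g : seq A -> nat) : (p <= n)%N ->
  \sum_(u : n.+1.-tuple A | Q u) g u =
  \sum_(a : A) \sum_(u : n.-tuple A | Q (ins p a u)) g (ins p a u).
Proof.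
move=> pn; rewrite pair_big_dep /=; have pn1 : (p < n.+1)%N by [].
have ltp (w : n.+1.-tuple A) : (p < size w)%N by rewrite size_tuple ltnS.
have sz (w : n.+1.-tuple A) : size (take p w ++ drop p.+1 w) == n.
  rewrite size_cat size_drop size_takel ?size_tuple ?subSS ?subnKC //.
  exact: leqW.
pose del (w : n.+1.-tuple A) : A * n.-tuple A :=
  (tnth w (Ordinal pn1), Tuple (sz w)).
rewrite (reindex (fun c : A * n.-tuple A => ins_tuple p c.1 c.2)) //=.
exists del => [[a u] _ | w _].
  have tp : size (take p u) = p by rewrite size_takel // size_tuple.
  congr pair; first by rewrite (tnth_nth a) /= /ins nth_cat tp ltnn subnn.
  apply: val_inj; rewrite /= /ins take_size_cat // drop_cat tp ltnNge leqnSn /=.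
  by rewrite subSnn /= drop0 cat_take_drop.
apply: val_inj; rewrite /= /ins.
have tp : size (take p w) = p by rewrite size_takel // size_tuple leqW.
rewrite take_size_cat // drop_size_cat //.
by rewrite (tnth_nth (thead w)) -drop_nth // cat_take_drop.
Qed.

End InsertSum.

(** * Faces of the type B arrangement as words with ties *)

Section Words.
Variables (R : realType) (d : nat) (I : finType) (y : I -> 'rV[R]_d).
Notation E := 'rV[R]_d.
Notation letter := (I * bool * bool)%type.
Implicit Types (a b : letter) (u : seq letter) (l : seq I) (H : seq E).

(** A letter (i, e, t) stands for the signed vector (-1)^e y_i, and the flag t
    ties its value to that of the next letter, or to 0 for the last letter.  A
    word whose indices run once through l encodes a face of the type B
    arrangement of the vectors y_i, i in l, together with a chamber around this
    face: the chamber is found by dropping the ties. *)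
Definition idx u : seq I := [seq a.1.1 | a <- u].
Definition ties u : bitseq := [seq a.2 | a <- u].
Definition nties u : nat := count snd u.
Definition sgv a : E := (-1) ^+ a.1.2 *: y a.1.1.

(** The empty word leads with 0 because the value of the last letter is
    compared with 0. *)
Definition lead u : E := if u is a :: _ then sgv a else 0.

(** The family of vectors in the definition of type B general position. *)
Fixpoint diffs u : seq E :=
  if u is a :: u' then (sgv a - lead u') :: diffs u' else [::].

Fixpoint on_face u (v : E) : bool :=
  if u is a :: u' then
    (let t := dotp v (sgv a - lead u') in if a.2 then t == 0 else 0 < t)
    && on_face u' v
  else true.

Definition orth H (v : E) : bool := all (fun h => dotp v h == 0) H.

(** A subspace is given by a list H of normals, so that cutting it by a
    hyperplane only adds an entry to H. *)
Definition meets H u : bool := `[< exists2 v, orth H v & on_face u v >].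

(** The subspace orthogonal to H meets every flat of the arrangement in the
    expected dimension. *)
Definition gen_pos H l := forall u, perm_eq (idx u) l -> forall m : bitseq,
  (size H + size (mask m (diffs u)) <= d)%N -> free (H ++ mask m (diffs u)).

Lemma size_diffs u : size (diffs u) = size u.
Proof. by elim: u => //= a u ->. Qed.

Lemma lead_drop a u p : (p < size u)%N -> lead (drop p u) = sgv (nth a u p).
Proof. by move=> pu; rewrite (drop_nth a pu). Qed.

Lemma idx_ins p a u : perm_eq (idx (ins p a u)) (a.1.1 :: idx u).
Proof. by rewrite /idx /ins map_cat /= perm_catC /= perm_cons perm_catC -map_cat cat_take_drop. Qed.

Lemma nties_ins p a u : nties (ins p a u) = (a.2 + nties u)%N.
Proof. by rewrite /nties /ins count_cat /= addnCA -count_cat cat_take_drop. Qed.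

Lemma perm_idx_ins p a u l :
  perm_eq (idx (ins p a u)) l =
  (a.1.1 \in l) && perm_eq (idx u) (rem a.1.1 l).
Proof.
rewrite (permPl (idx_ins p a u)); case: (boolP (a.1.1 \in l)) => /= al.
  by rewrite (permPr (perm_to_rem al)) perm_cons.
by apply: contraNF al => /perm_mem <-; rewrite mem_head.
Qed.

(** A tied letter contributes one equation; under this equation it can be
    replaced by the next letter in the comparison with the preceding one. *)
Lemma on_face_ins_tie p i e u v : (p <= size u)%N ->
  on_face (ins p (i, e, true) u) v =
  (dotp v (sgv (i, e, true) - lead (drop p u)) == 0) && on_face u v.
Proof.
elim: p u => [|p IH] [|b u] //= pu.
rewrite -!/(ins p _ u) IH // andbCA; case: eqP => //= h0; congr andb.
suff -> : dotp v (sgv b - lead (ins p (i, e, true) u)) =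
          dotp v (sgv b - lead u) by [].
case: p h0 {IH} pu => [|p]; last by case: u.
rewrite drop0 ins0 /= !dotpBr => /eqP; rewrite subr_eq0 => /eqP -> //.
Qed.

(** A letter at position p is bounded above by the letter before it; at
    position 0 there is none. *)
Definition below p u (v x : E) : bool :=
  if p is q.+1 then dotp v x < dotp v (lead (drop q u)) else true.

(** The comparison between the two neighbours of the new letter is no longer a
    condition of the word, but it follows by transitivity. *)
Lemma on_face_ins_strict p i e u v : (p <= size u)%N -> nties u = 0%N ->
  on_face (ins p (i, e, false) u) v =
  [&& on_face u v, below p u v (sgv (i, e, false)) &
      0 < dotp v (sgv (i, e, false) - lead (drop p u))].
Proof.
elim: p u => [|p IH] [|b u] //= pu.
- by rewrite andbT.
- by rewrite andbC.
rewrite /nties /=; case: b => [[ib eb] []] //= nt.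
rewrite -!/(ins p _ u) IH //.
case: p pu {IH} => [|p] pu /=.
  rewrite ins0 drop0 /= !dotpBr !subr_gt0.
  have [h1 /=|] := boolP (dotp v (lead u) < _); rewrite ?andbF ?andbT //.
  have [h2 /=|] := boolP (dotp v (sgv (i, e, false)) < _); rewrite ?andbF //=.
  by rewrite (lt_trans h1 h2) andbT.
by case: u pu {nt} => //= c u pu; rewrite -!andbA.
Qed.

Lemma on_face_chain p u v : (p < size u)%N -> nties u = 0%N -> on_face u v ->
  dotp v (lead (drop p.+1 u)) < dotp v (lead (drop p u)).
Proof.
elim: p u => [|p IH] [|b u] //= pu; rewrite /nties /=; case: b => [[ib eb] []] //= nt.
  by rewrite drop0 dotpBr subr_gt0 => /andP[].
by move=> /andP[_]; exact: IH.
Qed.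

Lemma gen_pos_behead H i l : gen_pos H (i :: l) -> gen_pos H l.
Proof.
move=> gp u ul m; have := gp ((i, false, false) :: u).
by rewrite /= perm_cons => /(_ ul (false :: m)).
Qed.

(** Inserting a letter adds one difference, the wall [sgv a - lead (drop p u)].
    Only the difference just before it changes, and it changes by the wall. *)
Lemma span_diffs_ins p a u (m : bitseq) : (p <= size u)%N -> exists m',
  size (mask m' (diffs (ins p a u))) = (size (mask m (diffs u))).+1 /\
  (<<mask m' (diffs (ins p a u))>> =
   <[sgv a - lead (drop p u)]> + <<mask m (diffs u)>>)%VS.
Proof.
elim: p u m => [|p IH] [|b u] m //= pu.
- exists [:: true]; rewrite /= mask0; split=> //.
  by rewrite span_cons.
- by exists (true :: m); rewrite /= span_cons; split.
have [b0 [m0 mE]] : exists (b0 : bool) (m0 : bitseq),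
    mask m ((sgv b - lead u) :: diffs u) =
    mask (b0 :: m0) ((sgv b - lead u) :: diffs u).
  by case: m => [|b0 m0]; [exists false, [::] | exists b0, m0].
rewrite mE -!/(ins p _ u) /=.
case: p pu IH => [|p] pu IH.
  exists (b0 :: true :: m0); rewrite /= ins0 /=; split.
    by case: (b0).
  rewrite drop0; case: b0 {mE} => /=; last by rewrite span_cons.
  rewrite !span_cons !addvA; congr (_ + _)%VS.
  set h := sgv a - lead u; set x := _ - lead u.
  have -> : sgv b - sgv a = x - h by rewrite /x /h opprB addrA subrK.
  apply/eqP; rewrite eqEsubv !subv_add; apply/andP; split; rewrite -!memvE.
    apply/andP; split; last by rewrite (subvP (addvSl _ _)) ?memv_line.
    rewrite rpredB //; first by rewrite (subvP (addvSr _ _)) ?memv_line.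
    by rewrite (subvP (addvSl _ _)) ?memv_line.
  apply/andP; split; first by rewrite (subvP (addvSr _ _)) ?memv_line.
  rewrite -{1}[x](subrK h) rpredD //.
    by rewrite (subvP (addvSl _ _)) ?memv_line.
  by rewrite (subvP (addvSr _ _)) ?memv_line.
have [m' [s1 s2]] := IH u m0 pu.
exists (b0 :: m'); split; first by case: (b0); rewrite /= s1.
rewrite /=.
have -> : lead (ins p.+1 a u) = lead u by case: u pu {IH s1 s2 mE}.
by case: (b0); rewrite // !span_cons s2 !addvA (addvC <[sgv b - lead u]>%VS).
Qed.

Lemma free_span_congr H (s t : seq E) : size s = size t ->
  span s = span t -> free (H ++ s) = free (H ++ t).
Proof. by move=> st sE; rewrite /free !size_cat !span_cat sE st. Qed.

(** If x_i equals, on the hyperplane orthogonal to h, the value of a letter of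
    u up to sign, or 0, then i can be inserted next to that letter, and the
    differences of u modulo h become differences of the longer word. *)
Lemma gen_pos_cut H i l h : gen_pos H (i :: l) ->
  (forall u, perm_eq (idx u) l -> exists p e, [/\ (p <= size u)%N &
     (<[h]> = <[sgv (i, e, false) - lead (drop p u)]>)%VS]) ->
  gen_pos (h :: H) l.
Proof.
move=> gp hh u ul m /= sz.
have [p [e [pu hE]]] := hh u ul.
have [m' [s1 s2]] := span_diffs_ins (i, e, false) m pu.
have := gp (ins p (i, e, false) u); rewrite (permPl (idx_ins _ _ _)) perm_cons.
move=> /(_ ul m'); rewrite s1 -addSnnS => /(_ sz).
have -> : free (h :: H ++ mask m (diffs u)) = free (H ++ h :: mask m (diffs u)).
  exact: (perm_free (permEl (perm_catCA [:: h] H _))).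
by rewrite (free_span_congr H (t := h :: mask m (diffs u))) ?span_cons ?s2 ?hE.
Qed.

End Words.

(** * Cutting a cone by a hyperplane *)

Section Cut.
Variables (R : realType) (d : nat).
Notation E := 'rV[R]_d.
Implicit Types (H s : seq E) (f v : E).

Definition pos_on s v : bool := all (fun z => 0 < dotp v z) s.

Lemma pos_on_near s c u : pos_on s c ->
  exists2 e : R, 0 < e & forall t, `|t| <= e -> pos_on s (c + t *: u).
Proof.
elim: s => [_|z s IH /= /andP[z0 /IH[e e0 he]]]; first by exists 1.
pose M := `|dotp u z| + 1.
have M0 : 0 < M by rewrite ltr_wpDl.
(* M exceeds |<u, z>|, so this step changes <c, z> by at most its half. *)
exists (Num.min e (dotp c z / (2 * M))) => [|t].
  by rewrite lt_min e0 divr_gt0 // mulr_gt0.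
rewrite le_min => /andP[te tz]; rewrite he // andbT dotpDl dotpZl.
have : `|t * dotp u z| <= dotp c z / 2.
  rewrite normrM; apply: (@le_trans _ _ (dotp c z / (2 * M) * M)).
    by apply: ler_pM => //; rewrite /M lerDl.
  by rewrite invfM mulrA mulfVK ?gt_eqF.
by rewrite ler_norml => /andP[+ _]; lra.
Qed.

Lemma orth_lin H a b u v : orth H u -> orth H v -> orth H (a *: u + b *: v).
Proof.
move=> /allP hu /allP hv; apply/allP => h hH /=.
by rewrite dotpDl !dotpZl (eqP (hu h hH)) (eqP (hv h hH)) !mulr0 addr0.
Qed.

(** A nonempty open convex cone lies on one side of a hyperplane, or it meets
    both sides and the hyperplane.  Two points on different sides give a point
    of the hyperplane by convexity; conversely a point of the hyperplane can be
    moved to both sides because f is independent of H. *)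
Lemma cut_cone H s f : free (f :: H) ->
  (`[< exists2 v, orth H v & pos_on s v >] +
   `[< exists2 v, orth H v & (dotp v f == 0)%R && pos_on s v >] =
   `[< exists2 v, orth H v & (0 < dotp v f)%R && pos_on s v >] +
   `[< exists2 v, orth H v & (dotp v f < 0)%R && pos_on s v >])%N.
Proof.
move=> fr.
have [u hu] := free_dual_in (fun x => if x == f then 1 else 0) fr.
have uf : dotp u f = 1 by rewrite hu ?mem_head // eqxx.
have uH : orth H u.
  apply/allP => h hH /=; rewrite hu ?in_cons ?hH ?orbT //.
  case: (h =P f) => // hf; move: fr; rewrite free_cons -hf => /andP[].
  by rewrite memv_span.
set X := `[< _ >]; set Z := `[< _ >]; set P := `[< _ >]; set N := `[< _ >].
have XE : X = P || N || Z.
  apply/asboolP/idP => [[v vH vs]|].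
    have [v0|v0|/eqP v0] := ltgtP (dotp v f) 0.
    - by rewrite -orbA orbCA; apply/orP; left; apply/asboolP; exists v; rewrite ?v0.
    - by rewrite -orbA; apply/orP; left; apply/asboolP; exists v; rewrite ?v0.
    - by apply/orP; right; apply/asboolP; exists v; rewrite ?v0.
  by move=> /orP[/orP[]|] /asboolP[v vH /andP[_ vs]]; exists v.
have ZE : Z = P && N.
  apply/asboolP/andP => [[v vH /andP[/eqP v0 vs]]|].
    have [e e0 he] := pos_on_near u vs.
    split; apply/asboolP; [exists (v + e *: u) | exists (v + (- e) *: u)].
    - by rewrite -[v]scale1r; exact: orth_lin.
    - rewrite dotpDl v0 add0r dotpZl uf mulr1 e0 he //.
      by rewrite gtr0_norm.
    - by rewrite -[v]scale1r; exact: orth_lin.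
    - rewrite dotpDl v0 add0r dotpZl uf mulr1 oppr_lt0 e0 he //.
      by rewrite normrN gtr0_norm.
  move=> [/asboolP[a aH /andP[a0 sa]] /asboolP[b bH /andP[b0 sb]]].
  (* This zero of f lies in the cone, which is closed under positive combinations. *)
  exists (- dotp b f *: a + dotp a f *: b); first exact: orth_lin.
  rewrite dotpDl !dotpZl mulNr [X in _ + X]mulrC addNr eqxx /=.
  apply/allP => z zs; rewrite /= dotpDl !dotpZl addr_gt0 // mulr_gt0 ?oppr_gt0 //.
    exact: (allP sa).
  exact: (allP sb).
by rewrite XE ZE; case: P N {XE ZE} => [] [].
Qed.

End Cut.

Section Counting.
Variables (R : realType) (d : nat) (I : finType) (y : I -> 'rV[R]_d).
Notation E := 'rV[R]_d.
Notation letter := (I * bool * bool)%type.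
Implicit Types (a b : letter) (u : seq letter) (l : seq I) (H : seq E).
Local Open Scope nat_scope.

Lemma sum_leads (X : E -> nat) u :
  \sum_(p < (size u).+1) X (lead y (drop p u)) =
  \sum_(b <- u) X (sgv y b) + X 0%R.
Proof.
elim: u => [|a u IH]; first by rewrite big_ord_recl big_ord0 big_nil addn0.
by rewrite big_ord_recl /= big_cons -addnA -IH.
Qed.

(** The sum runs over the hyperplanes that the index i adds to the arrangement
    of l.  The hyperplane orthogonal to y_i counts twice since a letter tied to
    0 can have either sign. *)
Definition wall_sum (F : E -> nat) i l : nat :=
  \sum_(j <- l) \sum_(e : bool) F (y i - (-1) ^+ e *: y j)%R + 2 * F (y i).

(** The letter before which i is inserted runs through u, and the sign of i
    then gives both relative signs. *)
Lemma sum_walls (F : E -> nat) i l u : (forall h, F (- h)%R = F h) ->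
  perm_eq (idx u) l ->
  \sum_(e : bool) \sum_(p < (size u).+1)
     F (sgv y (i, e, false) - lead y (drop p u))%R = wall_sum F i l.
Proof.
move=> FN ul; rewrite exchange_big.
rewrite (sum_leads (fun x => \sum_(e : bool) F (sgv y (i, e, false) - x)%R)).
congr (_ + _); last first.
  rewrite big_bool /sgv /= !subr0 expr1 expr0 scaleN1r scale1r FN; lia.
rewrite -(perm_big _ ul) big_map; apply: eq_bigr => -[[j f] t] _ /=.
rewrite !big_bool /sgv /= !expr1 !expr0 !scaleN1r !scale1r opprK.
case: f; rewrite !(expr1, expr0, scaleN1r, scale1r, opprK).
  by rewrite -(FN (_ + _)%R) opprD !opprK addnC.
by rewrite -(FN (- _ - _)%R) opprD !opprK addnC [RHS]addnC addnC.
Qed.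

Lemma eq_wall_sum (F G : E -> nat) i l :
  (forall e j, j \in l -> F (y i - (-1) ^+ (e : bool) *: y j)%R = G (y i - (-1) ^+ e *: y j)%R) ->
  F (y i) = G (y i) -> wall_sum F i l = wall_sum G i l.
Proof.
move=> FG FGi; rewrite /wall_sum FGi; congr (_ + _).
by apply: eq_big_seq => j jl; apply: eq_bigr => e _; exact: FG.
Qed.

Lemma wall_sum_const c i l : wall_sum (fun=> c) i l = 2 * (size l).+1 * c.
Proof.
rewrite /wall_sum; under eq_bigr do rewrite big_bool.
by rewrite big_const_seq count_predT iter_addn_0 /=; lia.
Qed.

Lemma wall_sum_sum (J : Type) (r : seq J) (Q : pred J) (F : J -> E -> nat) i l :
  \sum_(t <- r | Q t) wall_sum (F t) i l =
  wall_sum (fun h => \sum_(t <- r | Q t) F t h) i l.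
Proof.
rewrite /wall_sum big_split /= big_distrr /= exchange_big /=; congr (_ + _).
by apply: eq_bigr => j _; rewrite exchange_big.
Qed.

Lemma line_opp (v : E) : (<[- v]> = <[v]>)%VS.
Proof.
apply/eqP; rewrite eqEsubv -!memvE memvN memv_line.
by rewrite -{1}[v]opprK memvN memv_line.
Qed.

Lemma gen_pos_wall H i l : gen_pos y H (i :: l) ->
  (forall e j, j \in l -> gen_pos y ((y i - (-1) ^+ (e : bool) *: y j)%R :: H) l) /\
  gen_pos y (y i :: H) l.
Proof.
move=> gp; split=> [e j jl|]; apply: (gen_pos_cut gp) => u ul.
  have : j \in idx u by rewrite (perm_mem ul).
  move=> /mapP[b bu jE]; exists (index b u), (e (+) b.1.2).
  split; first exact: index_size.
  rewrite (lead_drop _ b) ?index_mem // nth_index // /sgv /= -jE.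
  set x := y i; set z := y j; case: (e) (b.1.2) => [] [] /=;
    rewrite !(expr1, expr0, scaleN1r, scale1r, opprK) //.
  - by rewrite -line_opp opprD.
  - by rewrite -line_opp opprD opprK.
exists (size u), false; split=> //.
by rewrite drop_size /sgv /= scale1r subr0.
Qed.

Lemma meetsN H h u : meets y ((- h)%R :: H) u = meets y (h :: H) u.
Proof.
by apply: asbool_equiv_eq; split=> -[v vH vu]; exists v; move: vH; rewrite //= dotpNr oppr_eq0.
Qed.

End Counting.

(** * Recursions for the numbers of chambers and faces met by a subspace *)

Section Recursions.
Variables (R : realType) (d : nat) (I : finType) (y : I -> 'rV[R]_d).
Notation E := 'rV[R]_d.
Notation letter := (I * bool * bool)%type.
Implicit Types (a b : letter) (u : seq letter) (l : seq I) (H : seq E).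
Local Open Scope nat_scope.

Definition face_count H n l r : nat :=
  \sum_(u : n.-tuple letter | perm_eq (idx u) l && (nties u == r)) meets y H u.

Lemma free_wall H i l a p u : gen_pos y H (i :: l) -> perm_eq (idx u) l ->
  a.1.1 = i -> p <= size u -> size H < d ->
  free ((sgv y a - lead y (drop p u))%R :: H).
Proof.
move=> gp ul ai pu szH.
have [m' [s1 s2]] := span_diffs_ins y a [::] pu.
have := gp (ins p a u); rewrite (permPl (idx_ins _ _ _)) ai perm_cons.
move=> /(_ ul m'); rewrite s1 addn1 => /(_ szH).
rewrite (free_span_congr H (t := [:: (sgv y a - lead y (drop p u))%R])) //.
  by rewrite (perm_free (permEl (perm_catC H [:: _]))).
by rewrite s2 span_seq1 span_nil addv0.
Qed.

Lemma on_face_strict u v : nties u = 0 -> on_face y u v = pos_on (diffs y u) v.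
Proof. by elim: u => [|[[i e] []] u IH] //=; rewrite /nties /= => nt; rewrite IH. Qed.

(** The values of the letters of u and the final 0 are decreasing thresholds
    for the value of (i, e).  Below the threshold p - 1, the cone is cut by the
    threshold p according to [cut_cone], and the sum over p telescopes. *)
Lemma half_cut H i e l u : gen_pos y H (i :: l) -> perm_eq (idx u) l ->
  nties u = 0 -> size H < d ->
  \sum_(p < (size u).+1) meets y H (ins p (i, e, false) u) +
    `[< exists2 v, orth H v & (dotp v (sgv y (i, e, false)) < 0)%R && on_face y u v >] =
  \sum_(p < (size u).+1)
     meets y ((sgv y (i, e, false) - lead y (drop p u))%R :: H) u + meets y H u.
Proof.
move=> gp ul nt szH; set x := sgv y _.
pose B p := `[< exists2 v, orth H v & below y p u v x && on_face y u v >].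
have -> : `[< exists2 v, orth H v & (dotp v x < 0)%R && on_face y u v >] =
          B (size u).+1.
  by rewrite /B /= drop_size /=; apply: asbool_equiv_eq;
     split=> -[v vH hv]; exists v; rewrite // dotp0r in hv *.
have -> : meets y H u = B 0 by [].
elim: {-2}(size u).+1 (leqnn (size u).+1) => [|p IH] pu.
  by rewrite !big_ord0.
rewrite !big_ord_recr /= [in RHS]addnAC -(IH (ltnW pu)) -!addnA; congr (_ + _).
have fr := free_wall gp ul (erefl : (i, e, false).1.1 = i) pu szH.
pose s := (if p is q.+1 then [:: (lead y (drop q u) - x)%R] else [::]) ++ diffs y u.
have sE v : pos_on s v = below y p u v x && on_face y u v.
  rewrite on_face_strict // /s /pos_on all_cat; congr andb.
  by case: (p) => //= q; rewrite andbT dotpBr subr_gt0.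
have below_next v : on_face y u v ->
    (dotp v x <= dotp v (lead y (drop p u)))%R -> below y p u v x.
  move=> vu; case: (p) pu => //= q qu /le_lt_trans; apply.
  exact: on_face_chain.
have := cut_cone s fr; rewrite -/x.
set Xc := `[< _ >]; set Zc := `[< _ >]; set Pc := `[< _ >]; set Nc := `[< _ >].
have -> : Xc = B p.
  by apply: asbool_equiv_eq; split=> -[v vH hv]; exists v; rewrite // sE in hv *.
have -> : Pc = meets y H (ins p (i, e, false) u).
  have aE v : (0 < dotp v (x - lead y (drop p u)))%R && pos_on s v =
              on_face y (ins p (i, e, false) u) v.
    by rewrite sE on_face_ins_strict // -/x andbC -andbA [RHS]andbCA.
  by apply: asbool_equiv_eq; split=> -[v vH hv]; exists v; rewrite // aE in hv *.
have -> : Nc = B p.+1.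
  apply: asbool_equiv_eq; split=> -[v vH].
    by rewrite sE dotpBr subr_lt0 => /and3P[h1 h2 h3]; exists v => //=; rewrite h1.
  by move=> /= /andP[h1 h2]; exists v; rewrite // sE dotpBr subr_lt0 h1 h2 below_next // ltW.
have -> : Zc = meets y ((x - lead y (drop p u))%R :: H) u.
  apply: asbool_equiv_eq; split=> -[v] /=.
    by move=> vH; rewrite sE => /and3P[h1 h2 h3]; exists v; rewrite /= ?h1.
  move=> /andP[h1 vH] h2; exists v; rewrite // sE h1 h2 andbT /=.
  by rewrite below_next // -subr_le0 -dotpBr (eqP h1).
by move=> <-; rewrite addnC.
Qed.

(** For the two signs of i the telescoping sums of [half_cut] leave the
    half-cones x_i < 0 and - x_i < 0, which [cut_cone] compares with the
    hyperplane x_i = 0. *)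
Lemma position_count H i l u : gen_pos y H (i :: l) -> perm_eq (idx u) l ->
  nties u = 0 -> size H < d ->
  \sum_(e : bool) \sum_(p < (size u).+1) meets y H (ins p (i, e, false) u) +
    meets y (y i :: H) u =
  meets y H u + wall_sum y (fun h => meets y (h :: H) u) i l.
Proof.
move=> gp ul nt szH.
have FN h : meets y ((- h)%R :: H) u = meets y (h :: H) u :> nat by rewrite meetsN.
rewrite -(sum_walls y i FN ul).
have h1 := half_cut false gp ul nt szH.
have h2 := half_cut true gp ul nt szH.
have fr := free_wall gp ul (erefl : (i, false, false).1.1 = i) (leqnn _) szH.
have := cut_cone (diffs y u) fr.
rewrite drop_size /= subr0 !big_bool /=.
set Xc := `[< _ >]; set Zc := `[< _ >]; set Pc := `[< _ >]; set Nc := `[< _ >].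
have -> : Xc = meets y H u.
  by apply: asbool_equiv_eq; split=> -[v vH hv]; exists v; rewrite // on_face_strict in hv *.
have -> : Zc = meets y (y i :: H) u.
  rewrite /Zc /sgv scale1r; apply: asbool_equiv_eq; split=> -[v] /=.
    by move=> vH /andP[h vu]; exists v; rewrite /= ?h // on_face_strict.
  by move=> /andP[h vH] vu; exists v; rewrite // h -on_face_strict.
have PE : Pc = `[< exists2 v, orth H v &
    (dotp v (sgv y (i, true, false)) < 0)%R && on_face y u v >].
  rewrite /Pc /sgv /= scale1r scaleN1r; apply: asbool_equiv_eq.
  by split=> -[v vH hv]; exists v; rewrite // dotpNr oppr_lt0 // on_face_strict in hv *.
have NE : Nc = `[< exists2 v, orth H v &
    (dotp v (sgv y (i, false, false)) < 0)%R && on_face y u v >].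
  by apply: asbool_equiv_eq; split=> -[v vH hv]; exists v; rewrite // on_face_strict in hv *.
rewrite -PE in h2; rewrite -NE in h1.
move: h1 h2; clear.
do 4!move: (\sum_(p < (size u).+1) _) => ?.
do 2!move: (nat_of_bool (meets _ _ _)) => ?.
by move: (nat_of_bool Pc) (nat_of_bool Nc) => ? ?; lia.
Qed.

Lemma sum_letters (F : letter -> nat) :
  \sum_a F a = \sum_(i : I) \sum_(e : bool) \sum_(t : bool) F (i, e, t).
Proof.
rewrite pair_bigA pair_bigA; apply: eq_bigr => -[[i e] t] _ //.
Qed.

Lemma sum_words_at n p l (g : seq letter -> nat) : p <= n ->
  \sum_(u : n.+1.-tuple letter | perm_eq (idx u) l) g u =
  \sum_(i | i \in l) \sum_(e : bool) \sum_(t : bool)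
    \sum_(u : n.-tuple letter | perm_eq (idx u) (rem i l)) g (ins p (i, e, t) u).
Proof.
move=> pn; rewrite (sum_ins (fun u => perm_eq (idx u) l) g pn) sum_letters.
rewrite [RHS]big_mkcond; apply: eq_bigr => i _.
have [il|il] := boolP (i \in l); last first.
  apply: big1 => e _; apply: big1 => t _; apply: big_pred0 => u.
  by rewrite perm_idx_ins (negPf il).
apply: eq_bigr => e _; apply: eq_bigr => t _; apply: eq_bigl => u.
by rewrite perm_idx_ins il.
Qed.

Lemma sum_words_through n l i (g : seq letter -> nat) : uniq l -> i \in l ->
  \sum_(u : n.+1.-tuple letter | perm_eq (idx u) l) g u =
  \sum_(e : bool) \sum_(t : bool)
    \sum_(u : n.-tuple letter | perm_eq (idx u) (rem i l))
      \sum_(p < n.+1) g (ins p (i, e, t) u).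
Proof.
move=> ul il.
have -> : \sum_(u : n.+1.-tuple letter | perm_eq (idx u) l) g u =
    \sum_(p < n.+1) \sum_(u : n.+1.-tuple letter | perm_eq (idx u) l)
      (nth i (idx u) p == i) * g u.
  rewrite exchange_big; apply: eq_bigr => u uP /=.
  rewrite -big_distrl /=; suff -> : \sum_(p < n.+1) (nth i (idx u) p == i) = 1 by rewrite mul1n.
  have iu : i \in idx u by rewrite (perm_mem uP).
  have uu : uniq (idx u) by rewrite (perm_uniq uP).
  have sz : size (idx u) = n.+1 by rewrite size_map size_tuple.
  have lt : index i (idx u) < n.+1 by move: iu; rewrite -index_mem sz.
  rewrite (bigD1 (Ordinal lt)) //= nth_index // eqxx big1 // => p.
  rewrite -val_eqE /= => pi; case: eqP => // np; case/eqP: pi.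
  have psz : p < size (idx u) by rewrite sz.
  by have := index_uniq i psz uu; rewrite np => ->.
under eq_bigr => p _.
  rewrite (@sum_words_at n p l (fun u => (nth i (idx u) p == i) * g u)); last first.
    by rewrite -ltnS.
  rewrite (bigD1 i) //= [X in _ + X]big1 ?addn0; last first.
    move=> k /andP[_ ki]; apply: big1 => e _; apply: big1 => t _; apply: big1 => u _.
    rewrite /idx /ins map_cat nth_cat size_map size_takel ?size_tuple -1?ltnS //.
    by rewrite ltnn subnn /= (negPf ki).
  over.
rewrite exchange_big; apply: eq_bigr => e _ /=.
rewrite exchange_big; apply: eq_bigr => t _ /=.
rewrite exchange_big; apply: eq_bigr => u _ /=.
apply: eq_bigr => p _.
rewrite {1}/idx {1}/ins map_cat nth_cat size_map size_takel ?size_tuple -1?ltnS //.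
by rewrite ltnn subnn /= eqxx mul1n.
Qed.

(** Deletion and restriction: the new hyperplanes of i cut a chamber of l
    into one more piece than the number of hyperplanes that meet it, and on each
    of them the arrangement of [i :: l] restricts to that of l. *)
Lemma chamber_step H n i l : uniq (i :: l) -> gen_pos y H (i :: l) ->
  size H < d -> size l = n ->
  face_count H n.+1 (i :: l) 0 + face_count (y i :: H) n l 0 =
  face_count H n l 0 + wall_sum y (fun h => face_count (h :: H) n l 0) i l.
Proof.
move=> ul gp szH szl.
rewrite /face_count -wall_sum_sum.
rewrite -[X in _ = X + _]/(\sum_(u : n.-tuple letter | _) _) -!big_split /=.
transitivity (\sum_(u : n.-tuple letter | perm_eq (idx u) l && (nties u == 0))
   (\sum_(e : bool) \sum_(p < n.+1) meets y H (ins p (i, e, false) u) +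
    meets y (y i :: H) u)); last first.
  apply: eq_bigr => u /andP[uP /eqP nt].
  by rewrite -(position_count gp uP nt szH) size_tuple.
rewrite big_split /=; congr (_ + _).
rewrite [LHS]big_mkcondr /=
  (sum_words_through n (fun u => if nties u == 0 then meets y H u : nat else 0)
    ul (mem_head i l)).
rewrite /= eqxx [RHS]exchange_big /=; apply: eq_bigr => e _ /=.
rewrite big_bool /= [X in X + _]big1 ?add0n; last first.
  by move=> u _; apply: big1 => p _; rewrite nties_ins.
rewrite [RHS]big_mkcondr /=; apply: eq_bigr => u _.
case: eqP => nt.
  by apply: eq_bigr => p _; rewrite nties_ins nt.
by apply: big1 => p _; rewrite nties_ins /= add0n; case: eqP nt.
Qed.

Lemma sum_ties u : \sum_(p < size u) nth false (ties u) p = nties u.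
Proof.
elim: u => [|a u IH]; first by rewrite big_ord0.
by rewrite big_ord_recl /= IH.
Qed.

(** Counting pairs of a word and one of its ties: removing the tied letter
    turns the tie into a hyperplane that cuts the subspace. *)
Lemma face_step H n l r : uniq l -> size l = n.+1 ->
  r.+1 * face_count H n.+1 l r.+1 =
  \sum_(i | i \in l) wall_sum y (fun h => face_count (h :: H) n (rem i l) r) i (rem i l).
Proof.
move=> ul szl.
rewrite /face_count big_distrr /= big_mkcondr /=.
transitivity (\sum_(p < n.+1) \sum_(u : n.+1.-tuple letter | perm_eq (idx u) l)
   (nth false (ties u) p && (nties u == r.+1)) * meets y H u).
  rewrite exchange_big; apply: eq_bigr => u _; rewrite -big_distrl /=.
  case: eqP => [nt|_]; last first.
    by rewrite big1 // => p _; rewrite andbF.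
  congr (_ * _); rewrite -nt; under eq_bigr do rewrite andbT.
  by rewrite -sum_ties size_tuple.
under [LHS]eq_bigr => p _.
  rewrite (@sum_words_at n p l
    (fun u => (nth false (ties u) p && (nties u == r.+1)) * meets y H u)); last first.
    by rewrite -ltnS.
  over.
rewrite exchange_big; apply: eq_bigr => i il /=.
rewrite /face_count -wall_sum_sum big_mkcondr exchange_big /=.
under eq_bigr => e _.
  under eq_bigr => p _.
    rewrite big_bool /= [X in _ + X]big1 ?addn0; last first.
      move=> u _; rewrite /ties /ins map_cat nth_cat size_map.
      rewrite size_takel ?size_tuple -1?ltnS // ltnn subnn /=.
      done.
    over.
  rewrite exchange_big; over.
rewrite exchange_big; apply: eq_bigr => u uP /=.
have FN h : meets y ((- h)%R :: H) u = meets y (h :: H) u :> nat by rewrite meetsN.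
rewrite -(sum_walls y i FN uP) size_tuple.
have nthE e (p : 'I_n.+1) : nth false (ties (ins p (i, e, true) u)) p.
  rewrite /ties /ins map_cat nth_cat size_map.
  by rewrite size_takel ?size_tuple -1?ltnS // ltnn subnn.
under eq_bigr => e _ do under eq_bigr => p _ do rewrite nthE nties_ins /= add1n eqSS.
case: eqP => _; last by apply: big1 => e _; apply: big1.
apply: eq_bigr => e _; apply: eq_bigr => p _; rewrite mul1n; congr nat_of_bool.
have pn : p <= size u by rewrite size_tuple -ltnS.
apply: asbool_equiv_eq; split=> -[v vH].
  rewrite on_face_ins_tie // => /andP[h1 h2]; exists v => //=.
  by rewrite vH andbT.
move: vH => /= /andP[h1 h2] h3; exists v => //.
by rewrite on_face_ins_tie // h3 andbT.
Qed.

End Recursions.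

(** * Solution of the recursions *)

Section TypeBNumbers.

Lemma Bnum0 k : Bnum 0 k = (k == 0)%:R.
Proof. by case: k => // k; rewrite /Bnum big_ord0 coef1. Qed.

Lemma BnumS n k : Bnum n.+1 k = (2 * n + 1)%N%:R * Bnum n k + Bnum n (k - 1).
Proof.
case: k => [[|k]|k]; last by rewrite mulr0 add0r.
  rewrite /Bnum big_ord_recr /= mulrDr coefD coefMX eqxx add0r coefMC mulrC.
  by rewrite addr0.
have -> : (Posz k.+1 - 1 = Posz k)%R by rewrite -addn1 PoszD addrK.
by rewrite /Bnum big_ord_recr /= mulrDr coefD coefMX /= coefMC mulrC addrC.
Qed.

Lemma Bnum_gt n (k : int) : n%:Z < k -> Bnum n k = 0.
Proof.
elim: n k => [|n IH] k nk; first by rewrite Bnum0; case: eqP nk => // ->.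
by rewrite BnumS !IH ?mulr0 ?addr0 //; lia.
Qed.

Lemma DB0 m : DB m 0 = 0.
Proof. by rewrite /DB big_ord0 mulr0. Qed.

(** Exactly one of the two coefficients of t + 1 occurs in the sum. *)
Lemma DB1 k : DB 1 k.+1 = 2.
Proof.
rewrite /DB; suff -> : \sum_(i < k.+1) Bnum 1 (1%:Z - k.+1%:Z + 1 + 2 * i%:Z) = 1 by [].
have BE (i : nat) : Bnum 1 (1%:Z - k.+1%:Z + 1 + 2 * i%:Z) =
     (i == k./2 :> nat)%:R.
  have -> : 1%:Z - k.+1%:Z + 1 + 2 * i%:Z = 1 + (2 * i%:Z - k%:Z) by lia.
  rewrite BnumS !Bnum0 mul1r addrAC subrr add0r -natrD.
  by congr (_%:R); lia.
under eq_bigr do rewrite BE.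
have kk : (k./2 < k.+1)%N by lia.
rewrite (bigD1 (Ordinal kk)) //= eqxx big1 ?addr0 // => i.
by rewrite -val_eqE /= => /negPf ->.
Qed.

(** The recursion [BnumS], summed over a parity class of indices. *)
Lemma DBS n k : DB n.+1 k.+1 = (2 * n + 1)%N%:R * DB n k + DB n k.+1.
Proof.
rewrite /DB mulrCA -mulrDr; congr (_ * _).
under eq_bigr do rewrite BnumS.
rewrite big_split -mulr_sumr /=; congr (_ * _ + _).
  rewrite big_ord_recr /= Bnum_gt ?addr0; last lia.
  by apply: eq_bigr => i _; congr Bnum; lia.
by apply: eq_bigr => i _; congr Bnum; lia.
Qed.

End TypeBNumbers.

Section Counts.
Variables (R : realType) (d : nat) (I : finType) (y : I -> 'rV[R]_d).
Notation E := 'rV[R]_d.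
Notation letter := (I * bool * bool)%type.
Implicit Types (a b : letter) (u : seq letter) (l : seq I) (H : seq E).

Lemma gen_pos_perm H l l' : perm_eq l l' -> gen_pos y H l -> gen_pos y H l'.
Proof. by move=> ll' gp u ul; apply: gp; rewrite (perm_trans ul) // perm_sym. Qed.

Lemma gen_pos_free H l : gen_pos y H l -> (size H <= d)%N -> free H.
Proof.
move=> gp sz; have := gp [seq (i, false, false) | i <- l].
rewrite /idx -map_comp map_id => /(_ (perm_refl _) [::]).
by rewrite mask0s /= addn0 cats0 => /(_ sz).
Qed.

Lemma face_count0 H : face_count y H 0 [::] 0 = 1%N.
Proof.
rewrite /face_count (big_pred1 [tuple]) => [|u]; last by rewrite tuple0 /= eqxx.
suff -> : meets y H [::] by [].
by apply/asboolP; exists 0 => //; apply/allP => h _; rewrite /= dotp0l.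
Qed.

Lemma orth_full H v : free H -> size H = d -> orth H v -> v = 0.
Proof.
move=> fH sH /allP hv; apply/eqP; rewrite -dotp_eq0.
have : v \in <<H>>%VS.
  have -> : <<H>>%VS = fullv; last exact: memvf.
  apply/eqP; rewrite eqEdim subvf dimvf /dim /= mul1n.
  by move: fH; rewrite /free sH => /eqP ->.
rewrite -[H]/(tval (in_tuple H)) => /coord_span {2}->.
rewrite dotp_sumr big1 // => i _; rewrite dotpZr.
by rewrite (eqP (hv _ _)) ?mulr0 // mem_nth.
Qed.

Lemma face_count_full H n l : gen_pos y H l -> size H = d ->
  face_count y H n.+1 l 0 = 0%N.
Proof.
move=> gp sH; apply: big1 => u /andP[_ /eqP nt]; apply/eqP; rewrite eqb0.
apply/asboolP => -[v vH].
have -> := orth_full (gen_pos_free gp (eq_leq sH)) sH vH.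
case: u nt => -[|[[i e] []] u] //= _; rewrite /nties /= => nt.
by rewrite dotp0l ltxx.
Qed.

(** The recursion [chamber_step] is the recursion [DBS].  It starts at one
    vector: without vectors the whole space is one chamber, whereas [DB 0 k] is
    0 or 2. *)
Theorem chamber_count n H l : uniq l -> size l = n.+1 -> gen_pos y H l ->
  (size H <= d)%N -> (face_count y H n.+1 l 0)%:Z = DB n.+1 (d - size H).
Proof.
elim: n H l => [|n IH] H [|i l] // ul [szl] gp.
all: rewrite leq_eqVlt => /orP[/eqP sH|sH];
  first by rewrite face_count_full // sH subnn DB0.
all: have [k kE] : exists k, (d - size H = k.+1)%N by exists (d - size H).-1; lia.
all: have := chamber_step ul gp sH szl; have [gw gi] := gen_pos_wall gp.
  move/eqP/nilP: szl => ->; rewrite (eq_wall_sum (G := fun=> 1%N)) ?face_count0 //.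
  rewrite wall_sum_const /= kE DB1. by rewrite addn1 => -[->].
have ul' : uniq l by case/andP: ul.
have IHh h : gen_pos y (h :: H) l -> (face_count y (h :: H) n.+1 l 0)%:Z = DB n.+1 k.
  by move=> gh; rewrite IH //; congr DB; rewrite /= subnS kE.
pose c := face_count y (y i :: H) n.+1 l 0.
rewrite (eq_wall_sum (G := fun=> c)) // => [|e j jl]; last first.
  by apply/eqP; rewrite -eqz_nat !IHh //; exact: gw.
rewrite wall_sum_const szl -/c => h.
have := IH H l ul' szl (gen_pos_behead gp) (ltnW sH).
have := IHh _ gi; rewrite -/c kE (DBS n.+1) => <- <-.
rewrite natz -PoszM -PoszD; congr Posz.
have aux (a b m e : nat) : (a + e = b + 2 * m.+2 * e -> a = (2 * m.+1 + 1) * e + b)%N.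
  lia.
exact: aux h.
Qed.

(** By [face_step], the count with r ties is 2 n^2 / r times the count with
    r - 1 ties for one vector and one dimension less; the case r = 0 is
    [chamber_count].  The factorial stands on the left to avoid a division. *)
Theorem face_count_formula r n H l : uniq l -> size l = n -> gen_pos y H l ->
  (r < n)%N -> (size H + r < d)%N ->
  (face_count y H n l r * (n - r)`!)%:Z =
  (2 ^ r * 'C(n, r) * n`!)%:Z * DB (n - r) (d - size H - r).
Proof.
elim: r n H l => [|r IH] [|n] H l // ul szl gp rn sH.
  rewrite bin0 !subn0 muln1 mul1n PoszM mulrC chamber_count //; lia.
pose f := (n - r)`!; have f0 : (0 < f)%N by exact: fact_gt0.
pose K := ((2 ^ r * 'C(n, r) * n`!)%:Z * DB (n - r) (d - (size H).+1 - r))%R.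
have TK h i : i \in l -> gen_pos y (h :: H) (rem i l) ->
    (face_count y (h :: H) n (rem i l) r * f)%:Z = K.
  move=> il gh; rewrite IH //=; first exact: rem_uniq.
  - by rewrite size_rem // szl.
  - by rewrite addSnnS.
(* The count with r ties is the same on all walls, equal to c. *)
pose c := (`|K| %/ f)%N.
have TC h i : i \in l -> gen_pos y (h :: H) (rem i l) ->
    face_count y (h :: H) n (rem i l) r = c.
  by move=> il gh; rewrite /c -(TK h i) // absz_nat mulnK.
have step := face_step y H r ul szl.
have {step} : (r.+1 * face_count y H n.+1 l r.+1 = n.+1 * (2 * n.+1 * c))%N.
  rewrite step -[X in _ = (X * _)%N]szl -sum1_size big_distrl /= [RHS]big_uniq //=.
  apply: eq_bigr => i il; rewrite mul1n.
  have [gw gi] := gen_pos_wall (gen_pos_perm (perm_to_rem il) gp).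
  rewrite (eq_wall_sum (G := fun=> c)) ?TC // => [|e j jl]; last by rewrite TC //; exact: gw.
  by rewrite wall_sum_const size_rem // szl.
have cK : (c * f)%:Z = K.
  case: l ul szl gp TK TC {IH} => [|i l] // ul szl gp TK TC.
  have [gw gi] := gen_pos_wall gp.
  have ei : rem i (i :: l) = l by rewrite /= eqxx.
  by rewrite -(TC (y i) i) ?TK ?ei ?mem_head.
move=> hT; apply: (@mulfI _ r.+1%:Z) => //.
rewrite -PoszM mulnA hT subSS -/f.
have -> : (n.+1 * (2 * n.+1 * c) * f)%N = (n.+1 * (2 * n.+1) * (c * f))%N by lia.
have dE : (d - (size H).+1 - r = d - size H - r.+1)%N by lia.
rewrite PoszM cK /K dE mulrA -PoszM [RHS]mulrA -PoszM; congr (Posz _ * _).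
rewrite factS expnS; have /= := mul_bin_diag n.+1 r.
move: 'C(n, r) 'C(n.+1, r.+1) (2 ^ r)%N n`! => x z p q xz.
transitivity (2 * n.+1 * p * q * (n.+1 * x))%N; first by lia.
by rewrite xz; lia.
Qed.

End Counts.

(** * Orthogonal complements and generic subspaces *)

Section Perp.
Variables (R : realType) (d : nat).
Notation E := 'rV[R]_d.
Implicit Types (H s : seq E) (U V W : {vspace E}) (x v : E).

(** Written as a kernel, so that the rank formula gives its dimension. *)
Definition perpv s : {vspace E} :=
  lker (linfun (mulmxr (\matrix_(j < d, i < size s) s`_i 0 j))).

Lemma mem_perpv s v : (v \in perpv s) = orth s v.
Proof.
rewrite memv_ker lfunE /=.
have mE i : (v *m \matrix_(j < d, i < size s) s`_i 0 j) 0 i = dotp v s`_i.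
  by rewrite mxE; apply: eq_bigr => j _; rewrite mxE.
apply/eqP/allP => [v0 _ /(nthP 0)[i lis <-]|v0].
  by rewrite -(mE (Ordinal lis)) v0 mxE.
by apply/rowP => i; rewrite mE mxE; apply/eqP/v0/mem_nth.
Qed.

Lemma dim_rV : \dim {:E} = d.
Proof. by rewrite dimvf /dim /= mul1n. Qed.

Lemma dim_rV_le U : (\dim U <= d)%N.
Proof. by rewrite -[X in (_ <= X)%N]dim_rV dimvS ?subvf. Qed.

Lemma dim_perpv_free s : free s -> (\dim (perpv s) + size s)%N = d.
Proof.
move=> fs; set A := \matrix_(j < d, i < size s) s`_i 0 j.
have := limg_ker_dim (linfun (mulmxr A) : 'Hom(E, 'rV[R]_(size s))) fullv.
rewrite capfv dim_rV => h; rewrite -[RHS]h; congr (_ + _)%N.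
suff -> : (linfun (mulmxr A) @: {:E} = fullv)%VS by rewrite dimvf /dim /= mul1n.
apply/eqP; rewrite eqEsubv subvf /=; apply/subvP => w _.
pose c (i : nat) := if insub i is Some j then w 0 j else 0.
have [v hv] := free_dual fs c.
apply/memv_imgP; exists v; first exact: memvf.
rewrite lfunE /=; apply/rowP => i; rewrite mxE.
transitivity (c i); first by rewrite /c valK.
by rewrite -hv //; apply: eq_bigr => j _; rewrite mxE.
Qed.

Lemma orth_span s v x : orth s v -> x \in span s -> dotp v x = 0.
Proof.
move=> /allP hv; rewrite -[s]/(tval (in_tuple s)) => /coord_span ->.
rewrite dotp_sumr big1 // => i _; rewrite dotpZr.
by rewrite (eqP (hv _ _)) ?mulr0 // mem_nth.
Qed.

Lemma orth_sub s t v : (<<t>> <= span s)%VS -> orth s v -> orth t v.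
Proof.
move=> /subvP st hs; apply/allP => x xt; rewrite /= (orth_span hs) //.
exact/st/memv_span.
Qed.

Lemma perpv_span s t : span s = span t -> perpv s = perpv t.
Proof.
move=> st; apply/vspaceP => v; rewrite !mem_perpv.
by apply/idP/idP; apply: orth_sub; rewrite st.
Qed.

Lemma span_vbasis U : <<vbasis U>>%VS = U.
Proof. exact: span_basis (vbasisP U). Qed.

Lemma free_vbasis U : free (vbasis U).
Proof. exact: basis_free (vbasisP U). Qed.

Lemma dim_perpv s : (\dim (perpv s) + \dim (span s))%N = d.
Proof.
rewrite (@perpv_span s (vbasis (span s))) ?span_vbasis //.
by rewrite -[X in (_ + X)%N](size_tuple (vbasis (span s))) dim_perpv_free // free_vbasis.
Qed.

Definition normals U : seq E := vbasis (perpv (vbasis U)).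

Lemma free_normals U : free (normals U).
Proof. exact: free_vbasis. Qed.

Lemma size_normals U : (\dim U + size (normals U))%N = d.
Proof.
by rewrite size_tuple addnC; have := dim_perpv (vbasis U); rewrite span_vbasis.
Qed.

Lemma perpv_normals U : perpv (normals U) = U.
Proof.
apply/esym/eqP; rewrite eqEdim; apply/andP; split.
  apply/subvP => v vU; rewrite mem_perpv; apply/allP => x xn /=.
  have : x \in perpv (vbasis U) by exact: vbasis_mem.
  rewrite mem_perpv => hx; rewrite dotpC (orth_span hx) ?span_vbasis //.
rewrite -(leq_add2r (size (normals U))) size_normals.
by rewrite dim_perpv_free ?free_normals.
Qed.

Lemma orth_normals U v : orth (normals U) v = (v \in U).
Proof. by rewrite -mem_perpv perpv_normals. Qed.

Lemma perpv_cat s t : perpv (s ++ t) = (perpv s :&: perpv t)%VS.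
Proof.
by apply/vspaceP => v; rewrite memv_cap !mem_perpv /orth all_cat.
Qed.

Lemma dim_cap_perp W x : x \in W -> x != 0 ->
  (\dim (W :&: perpv [:: x])).+1 = \dim W.
Proof.
move=> xW x0; set U := (W :&: _)%VS.
have xx : dotp x x != 0 by rewrite dotp_eq0.
have UW : (U <= W)%VS by exact: capvSl.
have -> : W = (U + <[x]>)%VS.
  apply/eqP; rewrite eqEsubv subv_add UW -memvE xW /= andbT.
  apply/subvP => w wW; apply/memv_addP.
  pose c := dotp w x / dotp x x.
  exists (w - c *: x); last by exists (c *: x); rewrite ?memvZ ?memv_line // subrK.
  rewrite memv_cap rpredB ?rpredZ // mem_perpv /= andbT dotpBl dotpZl.
  by rewrite /c divfK // subrr.
rewrite dimv_disjoint_sum ?dim_vline ?x0 ?addn1 //.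
apply/eqP; rewrite -subv0; apply/subvP => v.
rewrite memv_cap => /andP[+ /vlineP[k vk]]; rewrite memv_cap mem_perpv /= vk.
rewrite andbT dotpZl mulf_eq0 (negPf xx) orbF => /andP[_ /eqP ->].
by rewrite scale0r memv0.
Qed.

(** The reverse inequality holds for all subspaces, hence this is an
    equality. *)
Definition generic L V := (\dim (L :&: V) <= \dim L + \dim V - d)%N.

(** The space orthogonal to both the normals of L and some differences has the
    least possible dimension, hence these vectors are independent. *)
Lemma gen_pos_generic (I : finType) (y : I -> E) l L :
  gen_pos y [::] l ->
  (forall u, perm_eq (idx u) l -> forall m, generic L (perpv (mask m (diffs y u)))) ->
  gen_pos y (normals L) l.
Proof.
move=> gp gL u ul m; set s := mask m _ => sz.
have sL := size_normals L.
have fs : free s by apply: (gp u ul m); rewrite -/s /=; lia.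
have := gL u ul m; rewrite -/s /generic -{1}(perpv_normals L) -perpv_cat.
have h1 := dim_perpv_free fs; have h2 := dim_perpv (normals L ++ s).
have h3 := dim_span (normals L ++ s).
move=> h4; rewrite /free size_cat in h3 *; rewrite eqn_leq h3 /=; lia.
Qed.

End Perp.

(** * Rotations between hyperplanes of a subspace *)

Section Rotations.
Variables (R : realType) (d : nat).
Notation E := 'rV[R]_d.
Implicit Types (H s : seq E) (U V W : {vspace E}) (a x v : E) (Q : 'M[R]_d).

(** The block matrix with rows (1, u) and (v, 1) has two triangular
    factorizations. *)
Lemma det_rank1 (v : 'cV[R]_d) (u : 'rV[R]_d) :
  \det (1%:M - v *m u) = 1 - (u *m v) 0 0.
Proof.
pose X : 'M[R]_(1 + d) := block_mx 1%:M u v 1%:M.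
have X1 : X = block_mx 1%:M 0 v 1%:M *m block_mx 1%:M u 0 (1%:M - v *m u).
  rewrite mulmx_block !(mulmx1, mul1mx, mul0mx, mulmx0, addr0, add0r).
  by rewrite addrC subrK.
have X2 : X = block_mx 1%:M u 0 1%:M *m block_mx (1%:M - u *m v) 0 v 1%:M.
  rewrite mulmx_block !(mulmx1, mul1mx, mul0mx, mulmx0, addr0, add0r).
  by rewrite subrK.
have : \det X = \det X by [].
rewrite {1}X1 X2 !det_mulmx !det_ublock !det_lblock !det1 !mul1r !mulr1 => ->.
by rewrite det_mx11 !mxE eqxx.
Qed.

(** The reflection in the hyperplane orthogonal to a. *)
Definition refl a : 'M[R]_d := 1%:M - ((2 / dotp a a) *: a^T) *m a.

Lemma mul_refl a v : v *m refl a = v - (2 * dotp v a / dotp a a) *: a.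
Proof.
rewrite mulmxBr mulmx1; congr (_ - _); rewrite mulmxA -scalemxAr -scalemxAl.
have -> : v *m a^T = (dotp v a)%:M.
  rewrite [LHS]mx11_scalar mxE; congr (_%:M).
  by apply: eq_bigr => i _; rewrite mxE.
by rewrite mul_scalar_mx scalerA mulrAC.
Qed.

Lemma dotp_refl a u v : a != 0 -> dotp (u *m refl a) (v *m refl a) = dotp u v.
Proof.
rewrite -dotp_eq0 => a0; rewrite !mul_refl !dotpBl !dotpBr !dotpZl !dotpZr.
rewrite (dotpC a v); field.
exact: a0.
Qed.

Lemma refl_sym a u v : dotp (v *m refl a) u = dotp v (u *m refl a).
Proof.
by rewrite !mul_refl dotpBl dotpBr dotpZl dotpZr (dotpC a u); congr (_ - _); ring.
Qed.

Lemma orthogonalP Q : (forall u v, dotp (u *m Q) (v *m Q) = dotp u v) ->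
  Q *m Q^T = 1%:M.
Proof.
move=> hQ; apply/matrixP => i j.
have := hQ (delta_mx 0 i) (delta_mx 0 j); rewrite -!rowE dotp_delta !mxE.
by rewrite eqxx /= eq_sym => <-; apply: eq_bigr => k _; rewrite !mxE.
Qed.

Lemma refl_orthogonal a : a != 0 -> refl a *m (refl a)^T = 1%:M.
Proof. by move=> a0; apply: orthogonalP => u v; exact: dotp_refl. Qed.

Lemma det_refl a : a != 0 -> \det (refl a) = -1.
Proof.
rewrite -dotp_eq0 => a0; rewrite /refl det_rank1 -scalemxAr mxE.
have -> : (a *m a^T) 0 0 = dotp a a.
  by rewrite mxE; apply: eq_bigr => i _; rewrite mxE.
by rewrite divfK //; ring.
Qed.

Definition unitv x := (Num.sqrt (dotp x x))^-1 *: x.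

Lemma dotp_unitv x : x != 0 -> dotp (unitv x) (unitv x) = 1.
Proof.
move=> x0; have : 0 < dotp x x by rewrite lt_def dotp_eq0 x0 dotp_ge0.
move=> xx; rewrite dotpZl dotpZr mulrA -expr2 exprVn sqr_sqrtr ?ltW //.
by rewrite mulVf ?gt_eqF.
Qed.

Definition actv Q : 'End(E) := linfun (mulmxr Q).

Lemma lker_actv Q : Q *m Q^T = 1%:M -> lker (actv Q) == 0%VS.
Proof.
move=> QQ; apply/lker0P => u v; rewrite !lfunE /= => h.
by rewrite -[u]mulmx1 -[v]mulmx1 -QQ !mulmxA h.
Qed.

(** The reflection that exchanges the normalized vectors of x and x' maps one
    hyperplane to the other and preserves W, because x and x' lie in W.  A
    second reflection, which fixes the target hyperplane pointwise, makes the
    determinant equal to 1. *)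
Lemma rotation_hyperplane W x x' : x \in W -> x' \in W -> x != 0 -> x' != 0 ->
  exists2 Q, is_rotation Q &
    (actv Q @: (W :&: perpv [:: x]) = W :&: perpv [:: x'])%VS.
Proof.
move=> xW x'W x0 x'0.
have perp_unit z : z != 0 -> forall v, (dotp v (unitv z) == 0) = (dotp v z == 0).
  move=> z0 v; rewrite dotpZr mulf_eq0 invr_eq0 sqrtr_eq0 leNgt lt_def dotp_eq0 z0.
  by rewrite dotp_ge0.
set w := unitv x; set w' := unitv x'; pose a := w - w'.
have ww : dotp w w = 1 by exact: dotp_unitv.
have ww' : dotp w' w' = 1 by exact: dotp_unitv.
have [a0|a0] := eqVneq a 0.
  exists 1%:M; first by split; rewrite ?trmx1 ?mulmx1 ?det1.
  have -> : actv 1%:M = \1%VF by apply/lfunP => v; rewrite !lfunE /= mulmx1.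
  rewrite lim1g; apply/vspaceP => v; rewrite !memv_cap !mem_perpv /= !andbT.
  rewrite -(perp_unit x) // -(perp_unit x') // -/w -/w'.
  by have -> : w = w' by apply/eqP; rewrite -subr_eq0 -/a a0.
have w'0 : w' != 0 by rewrite -dotp_eq0 ww' oner_eq0.
have oQ : refl a *m refl w' *m (refl a *m refl w')^T = 1%:M.
  by rewrite trmx_mul mulmxA -(mulmxA (refl a)) refl_orthogonal // mulmx1 refl_orthogonal.
exists (refl a *m refl w').
  by split=> //; rewrite det_mulmx !det_refl // mulrNN mulr1.
apply/eqP; rewrite eqEdim; apply/andP; split; last first.
  rewrite limg_dim_eq; last by rewrite (eqP (lker_actv oQ)) capv0.
  by rewrite -ltnS !dim_cap_perp.
apply/subvP => _ /memv_imgP[v + ->]; rewrite !memv_cap !mem_perpv /= !andbT.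
rewrite -(perp_unit x) // -/w => /andP[vW vw].
(* The reflection along w - w' exchanges w and w'. *)
have aw' : w' *m refl a = w.
  have aE : dotp a a = - (2 * dotp w' a).
    by rewrite /a dotpBl !dotpBr ww ww' (dotpC w' w); ring.
  have a2 : 2 * dotp w' a != 0 by rewrite -oppr_eq0 -aE dotp_eq0.
  by rewrite mul_refl aE invrN mulrN mulfV // scaleN1r opprK /a addrC subrK.
have vaw : dotp (v *m refl a) w' = 0 by rewrite refl_sym aw' (eqP vw).
rewrite lfunE /= mulmxA [_ *m refl w']mul_refl vaw mulr0 mul0r scale0r subr0.
rewrite -(perp_unit x') // -/w' vaw eqxx andbT mul_refl.
by rewrite rpredB ?rpredZ // rpredB ?rpredZ.
Qed.

End Rotations.

(** * Open conditions on frames *)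

Section Openness.
Variable R : realType.

Definition rowspan p c (A : 'M[R]_(p, c)) : {vspace 'rV[R]_c} :=
  limg (linfun (mulmxr A)).

Lemma mem_rowspan p c (A : 'M[R]_(p, c)) v :
  reflect (exists a : 'rV[R]_p, v = a *m A) (v \in rowspan A).
Proof.
apply: (iffP memv_imgP) => [[a _ ->]|[a ->]]; exists a; rewrite ?lfunE //.
exact: memvf.
Qed.

Lemma span_rows p c (A : 'M[R]_(p, c)) :
  <<[seq row i A | i : 'I_p]>>%VS = rowspan A.
Proof.
apply/eqP; rewrite eqEsubv; apply/andP; split.
  apply/span_subvP => _ /mapP[i _ ->]; apply/mem_rowspan.
  by exists (delta_mx 0 i); rewrite -rowE.
apply/subvP => v /mem_rowspan[a ->]; rewrite mulmx_sum_row.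
apply: rpred_sum => i _; apply: rpredZ; apply: memv_span.
by apply/mapP; exists i; rewrite ?mem_enum.
Qed.

(** With its converse [minor_dim_rowspan] this expresses a lower bound for the
    rank as the nonvanishing of some determinant, an open condition.  The
    matrix Z comes from a family dual to a basis of the row space. *)
Lemma dim_rowspan_minor p c (A : 'M[R]_(p, c)) r : (r <= \dim (rowspan A))%N ->
  exists (X : 'M[R]_(r, p)) (Z : 'M[R]_(c, r)), X *m A *m Z = 1%:M.
Proof.
move=> rd; set b := vbasis (rowspan A).
have fb : free b := free_vbasis _.
have /boolp.choice[z hz] : forall j : 'I_r, exists v : 'rV[R]_c,
    forall i, (i < \dim (rowspan A))%N -> dotp v b`_i = (i == j :> nat)%:R.
  move=> j; have [v hv] := free_dual fb (fun i => (i == j :> nat)%:R).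
  by exists v => i li; rewrite hv // size_tuple.
have /boolp.choice[x hx] : forall i : 'I_r, exists v : 'rV[R]_p, b`_i = v *m A.
  move=> i; apply/mem_rowspan; apply: vbasis_mem; apply: mem_nth.
  by rewrite size_tuple (leq_trans (ltn_ord i)).
exists (\matrix_(i < r) x i), (\matrix_(k < c, j < r) z j 0 k).
apply/matrixP => i j; rewrite !mxE.
transitivity (dotp b`_i (z j)).
  apply: eq_bigr => k _; rewrite hx !mxE; congr (_ * _).
  by apply: eq_bigr => l _; rewrite !mxE.
by rewrite dotpC hz // (leq_trans (ltn_ord i)).
Qed.

Lemma minor_dim_rowspan p c (A : 'M[R]_(p, c)) r (X : 'M[R]_(r, p)) (Z : 'M[R]_(c, r)) :
  \det (X *m A *m Z) != 0 -> (r <= \dim (rowspan A))%N.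
Proof.
move=> dt; have /eqP XA0 :
    (fullv :&: lker (linfun (mulmxr (X *m A)) : 'Hom('rV[R]_r, 'rV[R]_c)) == 0)%VS.
  rewrite -subv0; apply/subvP => v; rewrite memv_cap memv_ker lfunE /=.
  move=> /andP[_ /eqP]; rewrite mulmxA => v0; rewrite memv0 -[v]mulmx1.
  have u : X *m A *m Z \in unitmx by rewrite unitmxE unitfE.
  by rewrite -(mulmxV u) !mulmxA v0 !mul0mx.
have := limg_dim_eq XA0; rewrite dimvf /dim /= mul1n => <-.
apply: dimvS; apply/subvP => v /memv_imgP[a _ ->]; rewrite lfunE /= mulmxA.
by apply/mem_rowspan; exists (a *m X).
Qed.

Lemma continuous_mulmx_entries (T : topologicalType) p q r
    (f : T -> 'M[R]_(p, q)) (g : T -> 'M[R]_(q, r)) :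
  (forall i j, continuous (fun t => f t i j)) ->
  (forall i j, continuous (fun t => g t i j)) ->
  forall i j, continuous (fun t => (f t *m g t) i j).
Proof.
move=> cf cg i j; under eq_fun => t do rewrite mxE.
apply: continuous_big => [|k _ t]; first exact: add_continuous.
by apply: continuousM; [exact: cf | exact: cg].
Qed.

Lemma continuous_det (T : topologicalType) p (f : T -> 'M[R]_p) :
  (forall i j, continuous (fun t => f t i j)) -> continuous (fun t => \det (f t)).
Proof.
move=> cf; rewrite /determinant.
apply: continuous_big => [|s _ t]; first exact: add_continuous.
apply: cvgMr.
have : continuous (fun x => \prod_i f x i (s i)); last exact.
apply: continuous_big.
  exact: mul_continuous.
by move=> i _; exact: cf.
Qed.

Lemma open_dim_rowspan m d c (N : 'M[R]_(d, c)) r :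
  open [set B : 'M[R]_(m, d) | (r <= \dim (rowspan (B *m N)))%N].
Proof.
pose f (XZ : 'M[R]_(r, m) * 'M[R]_(c, r)) (B : 'M[R]_(m, d)) :=
  \det (XZ.1 *m (B *m N) *m XZ.2).
rewrite (_ : mkset _ = \bigcup_XZ (f XZ @^-1` [set x | x != 0])).
  apply: bigcup_open => XZ _; apply: open_comp; last exact: open_neq.
  move=> B _; apply: continuous_det => i j.
  by do !apply: continuous_mulmx_entries => *;
    try exact: coord_continuous; exact: cst_continuous.
apply/seteqP; split=> [B /= /dim_rowspan_minor[X [Z XZ]]|B [[X Z] _ /=]].
  by exists (X, Z); rewrite //= /f /= XZ det1 oner_neq0.
exact: minor_dim_rowspan.
Qed.

Lemma cvg_mx_entries (T : Type) (F : set_system T) p q (f : T -> 'M[R]_(p, q)) (M : 'M[R]_(p, q)) :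
  Filter F -> (forall i j, f t i j @[t --> F] --> M i j) -> f t @[t --> F] --> M.
Proof.
move=> FF hf A [P PM PA].
have : F [set t | forall ij : 'I_p * 'I_q, P ij.1 ij.2 (f t ij.1 ij.2)].
  by apply: filter_forall => -[i j]; exact/hf/PM.
have sub : [set t | forall ij : 'I_p * 'I_q, P ij.1 ij.2 (f t ij.1 ij.2)] `<=` (f @^-1` A).
  by move=> t ht; apply: PA => i j; exact: (ht (i, j)).
exact: filterS sub.
Qed.

(** Each coefficient vector of norm 1 has a neighbourhood that is good for all
    frames near B; the unit sphere is compact. *)
Lemma open_avoid m d (F : set 'rV[R]_d) : closed F ->
  open [set B : 'M[R]_(m, d) | forall a : 'rV[R]_m, `|a| = 1 -> ~ F (a *m B)].
Proof.
move=> cF; rewrite openE => B hB.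
have cK : compact [set a : 'rV[R]_m | `|a| = 1].
  apply: bounded_closed_compact.
    by exists 1; split=> // x x1 a /= ->; exact: ltW.
  apply: (@closed_comp _ _ (fun a : 'rV[R]_m => `|a|) [set 1]).
    by move=> a _; exact: norm_continuous.
  exact: closed_eq.
have /compact_near_coveringP cov := cK.
apply: (cov _ (nbhs B) (fun B' a => ~ F (a *m B'))) => a /hB aB.
have opF : open (~` F) by exact: closed_openC.
have cv : (p.1 *m p.2) @[p --> (a, B)] --> a *m B.
  apply: cvg_mx_entries => i j.
  have c1 k l : continuous (fun q : 'rV[R]_m * 'M[R]_(m, d) => q.1 k l).
    move=> q; apply: (@continuous_comp _ _ _ fst (fun M : 'rV[R]_m => M k l)).
      exact: cvg_fst.
    exact: coord_continuous.
  have c2 k l : continuous (fun q : 'rV[R]_m * 'M[R]_(m, d) => q.2 k l).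
    move=> q; apply: (@continuous_comp _ _ _ snd (fun M : 'M[R]_(m, d) => M k l)).
      exact: cvg_snd.
    exact: coord_continuous.
  have cc := continuous_mulmx_entries c1 c2; move: (cc i j (a, B)); exact.
exact: (cv _ (open_nbhs_nbhs (conj opF aB))).
Qed.

End Openness.

(** * Measurable sets of subspaces *)

Section Grassmann.
Variables (R : realType) (d : nat) (m : 'I_d.+1).
Notation E := 'rV[R]_d.
Notation G := (borel_grass R m).
Implicit Types (V W : {vspace E}) (L : G).

Lemma dim_grass (L : G) : \dim (val L) = m.
Proof. exact/eqP/(valP L). Qed.

Lemma dim_rowspan_grass (B : 'M[R]_(m, d)) (L : G) :
  val L = <<[seq row i B | i : 'I_m]>>%VS -> (m <= \dim (rowspan (B *m 1%:M)))%N.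
Proof. by rewrite span_rows mulmx1 => <-; rewrite dim_grass. Qed.

Lemma grass_of_rowspan (B : 'M[R]_(m, d)) : (m <= \dim (rowspan B))%N ->
  exists L : G, val L = <<[seq row i B | i : 'I_m]>>%VS.
Proof.
move=> mB; have dB : \dim (rowspan B) == m.
  rewrite eqn_leq mB andbT -span_rows (leq_trans (dim_span _)) //.
  by rewrite size_map -cardE card_ord.
by exists (exist _ (rowspan B) dB); rewrite span_rows.
Qed.

Lemma ker_rowspan (B : 'M[R]_(m, d)) : (m <= \dim (rowspan B))%N ->
  (lker (linfun (mulmxr B) : 'Hom('rV[R]_m, E)) == 0)%VS.
Proof.
move=> mB; rewrite -dimv_eq0.
have := limg_ker_dim (linfun (mulmxr B) : 'Hom('rV[R]_m, E)) fullv.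
rewrite capfv -/(rowspan B) dimvf /dim /= mul1n => h.
by move: mB; rewrite -{1}h -{2}[\dim (rowspan B)]add0n leq_add2r leqn0.
Qed.

Definition special V : set G := [set L | ~ generic (val L) V].

(** Let the columns of N be normals of V.  For a frame B, genericity says that
    B N has rank at least the minimum of m and the codimension of V, which is
    an open condition on B. *)
Lemma measurable_special V : measurable (special V).
Proof.
rewrite -[special V]setCK; apply: measurableC; apply: sub_sigma_algebra.
rewrite /grass_open.
pose N := \matrix_(j < d, i < size (normals V)) (normals V)`_i 0 j.
have VN : V = lker (linfun (mulmxr N)) by rewrite -[LHS]perpv_normals.
pose r := minn m (d - \dim V).
rewrite (_ : mkset _ = [set B : 'M[R]_(m, d) | (m <= \dim (rowspan (B *m 1%:M)))%N] `&`
    [set B : 'M[R]_(m, d) | (r <= \dim (rowspan (B *m N)))%N]).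
  by apply: openI; exact: open_dim_rowspan.
have key (B : 'M[R]_(m, d)) : (m <= \dim (rowspan B))%N ->
    (generic (rowspan B) V) = (r <= \dim (rowspan (B *m N)))%N.
  move=> mB; have k0 := ker_rowspan mB.
  have dB : \dim (rowspan B) = m.
    have [L LB] := grass_of_rowspan mB.
    by rewrite -span_rows -LB dim_grass.
  have h : (\dim (rowspan B :&: V) + \dim (rowspan (B *m N)) = m)%N.
    have := limg_ker_dim (linfun (mulmxr N) : 'Hom(E, _)) (rowspan B).
    rewrite -VN dB => h; rewrite -[RHS]h; congr (_ + \dim _)%N.
    apply/vspaceP => v; apply/mem_rowspan/memv_imgP => [[a ->]|[u /mem_rowspan[a ->] ->]].
      by exists (a *m B); [apply/mem_rowspan; exists a | rewrite lfunE /= mulmxA].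
    by exists a; rewrite lfunE /= mulmxA.
  by rewrite /generic dB /r; have := dim_rV_le V; lia.
apply/seteqP; split=> [B [L gL LB]|B /= [mB rB]].
  have mB := dim_rowspan_grass LB; split=> //=; rewrite mulmx1 in mB.
  by rewrite -key // -span_rows -LB; move: gL => /=; rewrite /special /=; case: generic.
rewrite mulmx1 in mB; have [L LB] := grass_of_rowspan mB.
by exists L => //=; rewrite /special /= LB span_rows key // rB.
Qed.

(** A frame spans a subspace that meets the cone F only in 0 if and only if no
    combination of the frame with coefficients of norm 1 lies in F. *)
Lemma measurable_hits (F : set E) : closed F -> F 0 ->
  (forall (c : R) v, 0 < c -> F v -> F (c *: v)) ->
  measurable [set L : G | F `&` [set` val L] <> [set 0]].
Proof.
move=> cF F0 coneF.
rewrite -[X in measurable X]setCK; apply: measurableC; apply: sub_sigma_algebra.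
rewrite /grass_open.
rewrite (_ : mkset _ = [set B : 'M[R]_(m, d) | (m <= \dim (rowspan (B *m 1%:M)))%N] `&`
    [set B : 'M[R]_(m, d) | forall a : 'rV[R]_m, `|a| = 1 -> ~ F (a *m B)]).
  by apply: openI; [exact: open_dim_rowspan | exact: open_avoid].
apply/seteqP; split=> [B [L gL LB]|B /= [mB aB]].
  have mB := dim_rowspan_grass LB; split=> //= a a1 Fa; rewrite mulmx1 in mB.
  move: gL => /= /contrapT FL.
  have : (F `&` [set` val L]) (a *m B).
    by split=> //=; rewrite LB span_rows; apply/mem_rowspan; exists a.
  rewrite FL /= => aB0.
  have /lker0P inj := ker_rowspan mB.
  have a0 : a = 0 by apply: inj; rewrite !lfunE /= aB0 mul0mx.
  by move: a1; rewrite a0 normr0 => /eqP; rewrite eq_sym oner_eq0.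
rewrite mulmx1 in mB; have [L LB] := grass_of_rowspan mB.
exists L => //= ne; apply: ne; apply/seteqP.
split=> [v [Fv /= vL]|_ ->]; last by split=> //=; exact: mem0v.
move: vL; rewrite LB span_rows => /mem_rowspan[a va].
apply/eqP; apply: contrapT => /negP v0.
have a0 : 0 < `|a| by rewrite normr_gt0; apply: contraNneq v0 => a0; rewrite va a0 mul0mx.
apply: (aB (`|a|^-1 *: a)).
  by rewrite normrZ normfV normr_id mulVf ?gt_eqF.
by rewrite -scalemxAl -va; apply: coneF; rewrite ?invr_gt0.
Qed.

End Grassmann.

(** * Almost every subspace is generic *)

Section FewNull.
Local Open Scope ereal_scope.

(** Integrating the sum of the first N indicators gives N b <= p for all N. *)
Lemma null_of_finite_multiplicity (disp : measure_display) (T : measurableType disp)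
    (R : realType) (mu : probability T R) (A : nat -> set T) (b : \bar R) (p : nat) :
  (forall t, measurable (A t)) -> (forall t, mu (A t) = b) ->
  (forall x N, (count (fun t => x \in A t) (iota 0 N) <= p)%N) -> b = 0.
Proof.
move=> mA muA few.
have bound N : N%:R%:E * b <= p%:R%:E.
  have -> : N%:R%:E * b = \sum_(t <- iota 0 N) \int[mu]_x (\1_(A t) x)%:E.
    have e t : \int[mu]_x (\1_(A t) x)%:E = b.
      rewrite (integral_indic mu measurableT (mA t)) setIT; exact: muA.
    under eq_bigr do rewrite e.
    rewrite big_const_seq count_predT size_iota.
    elim: N => [|N IH] /=; first by rewrite mul0e.
    rewrite -IH -[N.+1]add1n natrD EFinD ge0_muleDl ?lee_fin //.
    by rewrite mul1e.
  have mI t : measurable_fun setT (fun x : T => (\1_(A t) x : R)%:E).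
    by apply/measurable_EFinP; exact: measurable_indic.
  have I0 t (x : T) : [set: T] x -> 0 <= (\1_(A t) x : R)%:E by rewrite lee_fin.
  rewrite -(ge0_integral_sum mu measurableT mI I0).
  apply: (@le_trans _ _ (\int[mu]_x (cst p%:R%:E x))); last first.
    rewrite integral_cst // [X in _ * X](_ : _ = 1) ?mule1 //.
    exact: probability_setT.
  apply: ge0_le_integral => //.
  - by move=> x _; apply: sume_ge0 => t _; rewrite lee_fin.
  - exact: emeasurable_sum.
  - move=> x _; rewrite sumEFin lee_fin; under eq_bigr do rewrite indicE.
    rewrite -natr_sum ler_nat; apply: leq_trans (few x N).
    by rewrite -sum1_count [leqRHS]big_mkcond; apply: leq_sum => t _; case: (_ \in _).
have b0 : 0 <= b by rewrite -(muA 0%N).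
have : b \is a fin_num.
  by rewrite ge0_fin_numE // (le_lt_trans _ (ltry p%:R)) //; have := bound 1%N; rewrite mul1e.
case: b {muA} b0 bound => // r; rewrite lee_fin => r0 bound _; congr (_%:E).
apply/eqP; rewrite eq_le r0 andbT leNgt; apply/negP => rp.
have := bound (Num.bound (p%:R / r)); rewrite -EFinM lee_fin leNgt => /negP; apply.
by rewrite -ltr_pdivrMr // archi_boundP // divr_ge0.
Qed.

End FewNull.

Section Null.
Variables (R : realType) (d : nat) (m : 'I_d.+1).
Notation E := 'rV[R]_d.
Notation G := (borel_grass R m).
Variable nu : probability G R.
Hypothesis nu_inv : rotation_invariant nu.
Implicit Types (V W : {vspace E}) (L : G).

Lemma special_rotate V Q : is_rotation Q ->
  rotate_set Q (special V : set G) = special (actv Q @: V)%VS.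
Proof.
move=> [oQ _]; have k0 := lker_actv oQ.
have dimQ U : \dim (actv Q @: U) = \dim U.
  by rewrite limg_dim_eq // (eqP k0) capv0.
have genE U U' : generic (actv Q @: U)%VS (actv Q @: U')%VS = generic U U'.
  by rewrite /generic -lker0_img_cap // !dimQ.
apply/seteqP; split=> [L' [L sL L'E]|L' sL'].
  by rewrite /special /= L'E -/(actv Q) genE.
have oQ' : Q^T *m Q = 1%:M by exact: mulmx1C.
have QK U : (actv Q @: (actv Q^T @: U))%VS = U.
  rewrite -limg_comp; suff -> : (actv Q \o actv Q^T)%VF = \1%VF by rewrite lim1g.
  by apply/lfunP => v; rewrite !lfunE /= !lfunE /= -mulmxA oQ' mulmx1.
have dL : \dim (actv Q^T @: val L')%VS == m by rewrite -dimQ QK dim_grass.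
exists (exist (fun L : {vspace E} => \dim L == m) _ dL : G); last by rewrite /= -/(actv Q) QK.
by rewrite /special /= -genE QK.
Qed.

Lemma nu_special_rotate V Q : is_rotation Q ->
  nu (special (actv Q @: V)%VS) = nu (special V).
Proof.
move=> rQ; rewrite -special_rotate //; apply: nu_inv => //.
exact: measurable_special.
Qed.

(** A moment curve in W: a nonzero vector of W is orthogonal to few of its
    points. *)
Definition moment W (t : nat) : E :=
  \sum_(i < \dim W) t%:R ^+ i *: (vbasis W)`_i.

Lemma moment_in W t : moment W t \in W.
Proof.
apply: rpred_sum => i _; apply: rpredZ; apply: vbasis_mem.
by rewrite mem_nth // size_tuple.
Qed.

Lemma moment_poly W x t :
  dotp x (moment W t) = (\poly_(i < \dim W) dotp x (vbasis W)`_i).[t%:R].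
Proof.
rewrite horner_poly dotp_sumr; apply: eq_bigr => i _.
by rewrite dotpZr mulrC.
Qed.

Lemma moment_count W x N : x \in W -> x != 0 ->
  (count (fun t => dotp x (moment W t) == 0%R) (iota 0 N) <= \dim W)%N.
Proof.
move=> xW x0; set p := \poly_(i < \dim W) dotp x (vbasis W)`_i.
have p0 : p != 0.
  apply: contraNneq x0 => pz; rewrite -dotp_eq0.
  rewrite {2}(coord_vbasis xW) dotp_sumr big1 // => i _.
  rewrite dotpZr; have := coef_poly (\dim W) (fun i => dotp x (vbasis W)`_i) i.
  by rewrite -/p pz coef0 ltn_ord => <-; rewrite mulr0.
rewrite -size_filter -(size_map (fun t : nat => t%:R : R)).
apply: (@leq_trans (size p)); last exact: size_poly.
apply: ltnW.
apply: max_poly_roots => //.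
  apply/allP => _ /mapP[t + ->]; rewrite mem_filter => /andP[/eqP h _].
  by rewrite rootE -moment_poly h.
rewrite map_inj_uniq ?filter_uniq ?iota_uniq // => a b /eqP.
by rewrite eqr_nat => /eqP.
Qed.

Lemma moment_neq0 W t : (0 < \dim W)%N -> moment W t != 0.
Proof.
move=> W0; apply/eqP => m0.
have /freeP fr := free_vbasis W.
have /eqP := fr (fun i : 'I__ => t%:R ^+ i) m0 (Ordinal W0).
by rewrite expr0 oner_eq0.
Qed.

(** Downward induction on the dimension of V, a hyperplane in a subspace W.
    The hyperplanes [Vt t] of W orthogonal to the points of a moment curve are
    images of V under rotations, so their exceptional sets have equal measure.
    If L is generic for W but exceptional for [Vt t], then L and W meet in a
    nonzero subspace of [Vt t], which happens for at most dim W values of t.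
    Hence the common measure is 0. *)
Lemma nu_special V : nu (special V) = 0.
Proof.
move: {2}(d - \dim V)%N (erefl (d - \dim V)%N) => c.
elim: c V => [|c IH] V dV.
  have -> : special V = set0 :> set G; last exact: measure0.
  apply/seteqP; split=> // L; rewrite /special /= /generic; apply.
  have dd : \dim V = d by apply/eqP; rewrite eqn_leq dim_rV_le /= -subn_eq0 dV.
  by rewrite dd addnK dimvS ?capvSl.
(* V is the hyperplane of W = V + <x> orthogonal to x. *)
pose N := perpv (vbasis V); pose x := vpick N.
have dN : \dim N = c.+1.
  have := dim_perpv (vbasis V); rewrite span_vbasis -/N => h.
  by rewrite -dV -[X in (X - _)%N]h addnK.
have x0 : x != 0 by rewrite vpick0 -dimv_eq0 dN.
have xN : orth (vbasis V) x by rewrite -mem_perpv memv_pick.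
pose W := (V + <[x]>)%VS.
have xW : x \in W by rewrite (subvP (addvSr _ _)) ?memv_line.
have VE : V = (W :&: perpv [:: x])%VS.
  apply/eqP; rewrite eqEdim; apply/andP; split.
    apply/subvP => v vV; rewrite memv_cap (subvP (addvSl _ _)) //.
    rewrite mem_perpv /= andbT dotpC; apply/eqP; apply: (orth_span xN).
    by rewrite span_vbasis.
  rewrite -ltnS dim_cap_perp //; apply: leq_trans (dimv_add_leqif _ _).1 _.
  by rewrite dim_vline x0 addn1.
have dW : (\dim V).+1 = \dim W by rewrite {1}VE dim_cap_perp.
have dWd : (d - \dim W = c)%N by rewrite -dW subnS dV.
pose Vt t := (W :&: perpv [:: moment W t])%VS.
have W0 : (0 < \dim W)%N by rewrite -dW.
have Vt_eq t : nu (special (Vt t)) = nu (special V).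
  have [Q rQ QE] := rotation_hyperplane xW (moment_in W t) x0 (moment_neq0 t W0).
  by rewrite /Vt -QE -VE nu_special_rotate.
have mS U : measurable (special U : set G) by exact: measurable_special.
apply: (@null_of_finite_multiplicity _ G R nu
  (fun t => special (Vt t) `\` special W) _ (\dim W)).
- by move=> t; apply: measurableD.
- move=> t; rewrite -(Vt_eq t); apply/esym.
  rewrite (measureDI nu (mS (Vt t)) (mS W)).
  rewrite [X in (_ + X)%E](_ : _ = 0) ?adde0 //.
  apply/eqP; rewrite eq_le measure_ge0 andbT -(IH W dWd) le_measure ?inE //.
  exact: measurableI.
move=> L M; pose U := (val L :&: W)%VS; pose z := vpick U.
have [U0|U0] := eqVneq U 0%VS.
  rewrite (_ : count _ _ = 0%N) //; apply/eqP; rewrite -leqn0 leqNgt -has_count.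
  apply/negP => /hasP[t _ /set_mem [+ _]]; rewrite /special /= /generic; apply.
  suff -> : (val L :&: Vt t = 0)%VS by rewrite dimv0.
  by apply/eqP; rewrite -subv0 -U0 /U capvA capvSl.
have z0 : z != 0 by rewrite vpick0.
have zU : z \in U by exact: memv_pick.
have zW : z \in W by move: zU; rewrite memv_cap => /andP[].
apply: leq_trans (moment_count M zW z0); apply: sub_count => t /set_mem [hV hW].
have {hV} : (\dim (val L) + \dim (Vt t) - d < \dim (val L :&: Vt t))%N.
  by rewrite ltnNge; apply/negP.
have {hW} : (\dim U <= \dim (val L) + \dim W - d)%N by apply: contrapT.
have : (\dim (Vt t)).+1 = \dim W by rewrite dim_cap_perp ?moment_in ?moment_neq0.
have U0' : (0 < \dim U)%N by rewrite lt0n dimv_eq0.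
have sub : (val L :&: Vt t <= U)%VS by rewrite /U /Vt capvA capvSl.
move=> e1 e2 e3.
have aux (k u v w a : nat) : (v.+1 = w -> u <= k + w - d -> k + v - d < a ->
    0 < u -> u <= a)%N by lia.
have : (val L :&: Vt t)%VS == U by rewrite eqEdim sub (aux _ _ _ _ _ e1 e2 e3).
move=> /eqP LE; have : z \in (val L :&: Vt t)%VS by rewrite LE.
by rewrite !memv_cap mem_perpv /= andbT => /andP[_ /andP[_]].
Qed.

End Null.

(** * Closed faces and the faces of polyhedral cones *)

Section Ties.
Variables (R : realType) (d : nat) (I : finType) (y : I -> 'rV[R]_d).
Notation E := 'rV[R]_d.
Notation letter := (I * bool * bool)%type.
Implicit Types (a b : letter) (u w : seq letter) (l : seq I) (H : seq E) (v : E).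

Definition retie u (t : bitseq) : seq letter := [seq (p.1.1, p.2) | p <- zip u t].

(** The chamber of a word. *)
Definition strip u : seq letter := [seq (a.1, false) | a <- u].

Lemma idx_strip u : idx (strip u) = idx u.
Proof. by rewrite /idx -map_comp. Qed.

Lemma nties_strip u : nties (strip u) = 0%N.
Proof. by rewrite /nties count_map; elim: u => //=. Qed.

Lemma lead_strip u : lead y (strip u) = lead y u.
Proof. by case: u. Qed.

Lemma diffs_strip u : diffs y (strip u) = diffs y u.
Proof. by elim: u => //= a u ->; rewrite lead_strip. Qed.

Lemma strip_id u : nties u = 0%N -> strip u = u.
Proof. by elim: u => [|[[i e] []] u IH] //=; rewrite /nties /= => nt; rewrite IH. Qed.

Lemma strip_retie u t : size t = size u -> strip (retie u t) = strip u.
Proof. by elim: u t => [|a u IH] [|b t] //= [st]; rewrite -/(retie u t) IH. Qed.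

Lemma ties_retie u t : size t = size u -> ties (retie u t) = t.
Proof. by elim: u t => [|a u IH] [|b t] //= [st]; rewrite -/(retie u t) IH. Qed.

Lemma nties_count u : nties u = count id (ties u).
Proof. by rewrite /ties count_map. Qed.

Lemma size_ties u : size (ties u) = size u.
Proof. exact: size_map. Qed.

Lemma strip_ties_inj u w : strip u = strip w -> ties u = ties w -> u = w.
Proof.
elim: u w => [|[[i e] t] u IH] [|[[j f] s] w] //= [-> -> h1] [-> h2].
by rewrite (IH _ h1 h2).
Qed.

Definition tied w : seq E := mask (ties w) (diffs y w).
Definition untied w : seq E := mask [seq ~~ t | t <- ties w] (diffs y w).

Lemma size_tied w : size (tied w) = nties w.
Proof. by rewrite size_mask ?size_ties ?size_diffs // nties_count. Qed.

Lemma on_faceE w v : on_face y w v = orth (tied w) v && pos_on (untied w) v.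
Proof.
elim: w => [|[[i e] t] w IH] //=; rewrite IH /tied /untied /orth /pos_on /=.
by case: t => /=; [rewrite andbA | rewrite andbCA].
Qed.

Definition nneg_on s v : bool := all (fun z : E => 0 <= dotp v z) s.

Definition closed_face w : set E := [set v | orth (tied w) v && nneg_on (untied w) v].

Lemma mem_diffs w z : (z \in diffs y w) = (z \in tied w) || (z \in untied w).
Proof.
elim: w => [|[[i e] t] w IH] //=; rewrite inE IH /tied /untied.
by case: t => /=; rewrite inE; [rewrite orbA | rewrite orbCA].
Qed.

Lemma closed_face_sub w v : closed_face w v -> nneg_on (diffs y w) v.
Proof.
move=> /andP[/allP h1 /allP h2]; apply/allP => z; rewrite mem_diffs.
by move=> /orP[/h1 /eqP -> //|/h2].
Qed.

Lemma on_face_closed w v : on_face y w v -> closed_face w v.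
Proof.
rewrite on_faceE => /andP[h1 /allP h2]; apply/andP; split=> //.
by apply/allP => z /h2 /ltW.
Qed.

(** The list s holds the differences whose tie is released. *)
Lemma tied_sub u w : all2 implb (ties u) (ties w) -> strip u = strip w ->
  exists s, perm_eq (tied w) (tied u ++ s) /\
    perm_eq (untied u) (s ++ untied w).
Proof.
elim: u w => [|[[i e] t] u IH] [|[[j f] t'] w] //=; first by exists [::].
move=> /andP[tt' h] [-> -> sE]; have [s [h1 h2]] := IH w h sE.
have lE : lead y u = lead y w by rewrite -lead_strip sE lead_strip.
rewrite /tied /untied /= -!/(tied _) -!/(untied _) lE.
case: t t' tt' => [] [] //= _; rewrite -!/(tied _) -!/(untied _).
- by exists s; rewrite perm_cons h1.
- set z := _ - _; exists (z :: s); rewrite /= !perm_cons h2; split=> //.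
  by rewrite (perm_trans _ (permEl (perm_catCA [:: z] _ _))) //= perm_cons.
- exists s; split=> //; set z := _ - _.
  by rewrite (perm_trans _ (permEl (perm_catCA [:: z] _ _))) //= perm_cons.
Qed.

(** The tied differences of w are independent modulo H.  Hence there is a
    direction, orthogonal to H, along which the released differences increase
    and the remaining tied ones stay 0; a small step in it keeps the strict
    inequalities of w. *)
Lemma untie H l u w : gen_pos y H l -> perm_eq (idx u) l ->
  all2 implb (ties u) (ties w) -> strip u = strip w ->
  (size H + nties w <= d)%N -> meets y H w -> meets y H u.
Proof.
move=> gp ul tt sE sz /asboolP[v vH].
have [s [h1 h2]] := tied_sub tt sE.
have wl : perm_eq (idx w) l by rewrite -idx_strip -sE idx_strip.
have fr : free (H ++ tied w) by apply: (gp w wl); rewrite -/(tied w) size_tied.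
have fr2 : free ((H ++ tied u) ++ s).
  by rewrite -catA (perm_free (_ : perm_eq _ (H ++ tied w))) // perm_cat2l perm_sym.
have [x hx] := free_dual_in (fun z => if z \in s then 1 else 0) fr2.
have xo z : z \in H ++ tied u -> dotp x z = 0.
  move=> zH; rewrite hx; last by rewrite mem_cat zH.
  have := free_uniq fr2; rewrite cat_uniq => /and3P[_ /hasPn hs _].
  by case: ifP => // /hs /=; rewrite zH.
have xs z : z \in s -> dotp x z = 1.
  by move=> zs; rewrite hx ?zs // mem_cat zs orbT.
rewrite on_faceE => /andP[/allP vt vu].
have [e e0 he] := pos_on_near x vu.
apply/asboolP; exists (v + e *: x).
  apply/allP => h hH /=; rewrite dotpDl dotpZl (eqP (allP vH h hH)).
  by rewrite xo ?mulr0 ?addr0 // mem_cat hH.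
rewrite on_faceE; apply/andP; split.
  apply/allP => z zu /=; rewrite dotpDl dotpZl xo ?mem_cat ?zu ?orbT //.
  rewrite mulr0 addr0; apply: vt; rewrite (perm_mem h1) mem_cat zu //.
rewrite /pos_on (perm_all _ h2) all_cat -/(pos_on (untied w) _) he ?gtr0_norm // andbT.
apply/allP => z zs /=; rewrite dotpDl dotpZl xs // mulr1.
by rewrite (eqP (vt z _)) ?add0r // (perm_mem h1) mem_cat zs orbT.
Qed.

Lemma dim_perpv_mask l u m : gen_pos y [::] l -> perm_eq (idx u) l ->
  \dim (perpv (mask m (diffs y u))) = (d - size (mask m (diffs y u)))%N.
Proof.
move=> gp ul; set s := mask m _.
have [sz|sz] := leqP (size s) d.
  have fs : free s by apply: (gp u ul m).
  by rewrite -[X in (X - _)%N](dim_perpv_free fs) addnK.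
(* d independent differences already span the space. *)
have /subseqP[m' _ mE] : subseq (take d s) (diffs y u).
  by apply: subseq_trans (take_subseq _ _) (mask_subseq _ _).
have st : size (take d s) = d by rewrite size_takel // ltnW.
have ft : free (take d s) by rewrite mE; apply: (gp u ul m'); rewrite -mE st.
have -> : (d - size s = 0)%N by apply/eqP; rewrite subn_eq0 ltnW.
apply/eqP; rewrite -leqn0 -(leq_add2r (size (take d s))) add0n {2}st.
rewrite -[X in (_ <= X)%N](dim_perpv_free ft) leq_add2r dimvS //.
apply/subvP => v; rewrite !mem_perpv; apply: orth_sub.
by apply: sub_span => x /mem_take.
Qed.

(** A point of the relatively open face can be moved in every direction
    orthogonal to the tied differences. *)
Lemma has_dim_closed_face l w : gen_pos y [::] l -> perm_eq (idx w) l ->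
  meets y [::] w -> has_dim (closed_face w) (d - nties w).
Proof.
move=> gp wl /asboolP[v0 _ hv0]; exists (perpv (tied w)); split.
- by rewrite (dim_perpv_mask _ gp wl) -/(tied w) size_tied.
- by move=> v /andP[vt _] /=; rewrite mem_perpv.
move=> V' FV'; apply/subvP => v; rewrite mem_perpv => vt.
have := hv0; rewrite on_faceE => /andP[v0t /pos_on_near -/(_ v)[e e0 he]].
have v0V : v0 \in V' by apply: FV'; exact: on_face_closed.
have : v0 + e *: v \in V'.
  apply: FV'; apply: on_face_closed; rewrite on_faceE he ?gtr0_norm // andbT.
  by rewrite -[v0]scale1r; exact: orth_lin.
by rewrite rpredDl // => /(rpredZ e^-1); rewrite scalerA mulVf ?gt_eqF // scale1r.
Qed.

Lemma has_dim_inj (F : set E) k k' : has_dim F k -> has_dim F k' -> k = k'.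
Proof.
move=> [V [<- FV mV]] [V' [<- FV' mV']].
by congr (\dim _); apply/eqP; rewrite eqEsubv mV // mV'.
Qed.

Lemma strict_tied u : nties u = 0%N -> tied u = [::].
Proof. by move=> nt; apply: size0nil; rewrite size_tied. Qed.

Lemma strict_untied u : nties u = 0%N -> untied u = diffs y u.
Proof.
elim: u => [|[[i e] []] u IH] //=; rewrite /nties /= => nt.
by rewrite /untied /= -/(untied u) IH.
Qed.

Lemma closed_cone u v : nties u = 0%N -> closed_face u v = nneg_on (diffs y u) v :> Prop.
Proof. by move=> nt; rewrite /closed_face /= strict_tied // strict_untied. Qed.

(** The sum of witnesses: each form that does not vanish identically on F is
    positive at some point of F. *)
Lemma rel_interior (F : set E) (zs : seq E) : F 0 ->
  (forall p q : E, F p -> F q -> F (p + q)) ->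
  (forall v, F v -> nneg_on zs v) ->
  exists2 v0, F v0 & forall z, z \in zs ->
    0 < dotp v0 z \/ forall v, F v -> dotp v z = 0.
Proof.
move=> F0 FD; elim: zs => [|z zs IH] Fz; first by exists 0.
have [v0 Fv0 hv0] := IH (fun v Fv => proj2 (andP (Fz v Fv))).
have [hz|] := pselect (forall v, F v -> dotp v z = 0).
  by exists v0 => // x; rewrite inE => /orP[/eqP ->|/hv0 //]; right.
move=> /existsNP[v1 /not_implyP[Fv1 /eqP v1z]]; exists (v0 + v1); first exact: FD.
have ge (v : E) (x : E) : F v -> x \in z :: zs -> 0 <= dotp v x.
  by move=> Fv xz; apply: (allP (Fz v Fv)).
move=> x; rewrite inE => /orP[/eqP ->|xz].
  left; rewrite dotpDl ltr_wpDl ?ge ?mem_head //.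
  by rewrite lt_def v1z ge ?mem_head.
have [h|h] := hv0 x xz; [left|by right].
by rewrite dotpDl ltr_wpDr // ge // inE xz orbT.
Qed.

Lemma closed_face_is_face u w : nties u = 0%N -> meets y [::] u -> strip w = u ->
  is_face (closed_face u) (closed_face w).
Proof.
move=> nt /asboolP[v0 _ hv0] wu.
have dE : diffs y w = diffs y u by rewrite -wu diffs_strip.
have sw : size w = size (diffs y u) by rewrite -dE size_diffs.
exists (size (diffs y u)), (fun i : 'I_(size (diffs y u)) => (diffs y u)`_i),
  (finset (fun i : 'I_(size (diffs y u)) => nth false (ties w) i)); split.
- move=> i; move: hv0; rewrite on_faceE strict_untied // => /andP[_ /allP h].
  have := h _ (mem_nth 0 (ltn_ord i)); case: eqP => // ->.
  by rewrite /= dotp0r ltxx.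
- apply/seteqP; split=> [v|v hv].
    by rewrite closed_cone // => /allP h i; apply: h; exact: mem_nth.
  rewrite closed_cone //; apply/(all_nthP 0) => i li.
  exact: (hv (Ordinal li)).
have tE : closed_face w = [set v |
    all (fun p => if p.2 then dotp v p.1 == 0 else 0 <= dotp v p.1)
      (zip (diffs y w) (ties w))].
  apply/seteqP; split=> v; rewrite /closed_face /tied /untied /=;
  elim: (ties w) (diffs y w) => [|[] t IH] [|z s] //=; rewrite -?andbA.
  + by move=> /and3P[-> h1 h2]; apply: IH; rewrite h1.
  + by rewrite andbCA => /and3P[-> h1 h2]; apply: IH; rewrite h1.
  + by move=> /andP[-> /IH].
  + by move=> /andP[-> /IH]; rewrite andbCA.
rewrite tE dE; apply/seteqP; split=> v /= hv.
  move=> i; move: hv => /allP /(_ ((diffs y u)`_i, nth false (ties w) i)) /=.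
  rewrite inE => h; have : ((diffs y u)`_i, nth false (ties w) i) \in zip (diffs y u) (ties w).
    rewrite -nth_zip ?size_ties //; apply: mem_nth.
    by rewrite size_zip size_ties sw minnn.
  by move=> /h; case: (nth _ _ _) => // /eqP.
apply/(all_nthP (0, false)) => i; rewrite size_zip size_ties sw minnn => li.
rewrite nth_zip ?size_ties //=; have := hv (Ordinal li); rewrite inE /=.
by case: (nth _ _ _) => // ->.
Qed.

(** Let F come from any representation of the cone by half-spaces with normals
    x_i, and let v0 be a relatively interior point of F.  If v lies in the
    closed face of the word that v0 realizes, then v0 - e v stays in the
    cone for small e, and as the x_i with i in S vanish at v0, they vanish at v.
    So F is the closed face of that word. *)
Lemma is_face_closed_face u F : nties u = 0%N -> is_face (closed_face u) F ->
  exists w, [/\ strip w = u, F = closed_face w & meets y [::] w].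
Proof.
move=> nt [m [x [S [_ CE FE]]]].
have FC v : F v -> closed_face u v.
  rewrite FE CE => hv i; have := hv i; case: ifP => // _ -> //.
have F0 : F 0 by rewrite FE => i; rewrite dotp0l; case: ifP.
have FD (p q : E) : F p -> F q -> F (p + q).
  rewrite FE => ha hb i; have := ha i; have := hb i; rewrite dotpDl.
  by case: ifP => _ hbi hai; rewrite ?hai ?hbi ?addr0 // addr_ge0.
have FN v : F v -> nneg_on (diffs y u) v by move=> /FC; rewrite closed_cone.
have [v0 Fv0 hv0] := rel_interior F0 FD FN.
pose van z := `[< forall v, F v -> dotp v z = 0 >].
pose w := retie u (map van (diffs y u)).
have szt : size (map van (diffs y u)) = size u by rewrite size_map size_diffs.
have wu : strip w = u by rewrite strip_retie // strip_id.
have dE : diffs y w = diffs y u by rewrite -wu diffs_strip.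
have tE : tied w = seq.filter van (diffs y u).
  by rewrite /tied ties_retie // dE filter_mask.
have uE : untied w = seq.filter (predC van) (diffs y u).
  by rewrite /untied ties_retie // dE filter_mask -map_comp.
have on0 : on_face y w v0.
  rewrite on_faceE tE uE; apply/andP; split; apply/allP => z; rewrite mem_filter.
    by move=> /andP[/asboolP h _]; apply/eqP/h.
  by move=> /andP[/asboolP h /hv0[]].
exists w; split=> //; last by apply/asboolP; exists v0.
apply/seteqP; split=> v.
  move=> Fv; have := FC v Fv; rewrite closed_cone // => /allP h.
  apply/andP; rewrite tE uE; split; apply/allP => z; rewrite mem_filter.
    by move=> /andP[/asboolP hz _]; apply/eqP/hz.
  by move=> /andP[_ /h].
move=> vw; have vC : closed_face u v.
  by rewrite closed_cone // -dE; exact: closed_face_sub.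
have := on0; rewrite on_faceE => /andP[v0t /pos_on_near -/(_ v)[e e0 he]].
have : closed_face u (v0 + - e *: v).
  rewrite closed_cone // -dE; apply: closed_face_sub; apply: on_face_closed.
  rewrite on_faceE he ?normrN ?gtr0_norm // andbT -[v0]scale1r.
  by apply: orth_lin => //; case/andP: vw.
rewrite CE => hve; move: vC; rewrite CE => hv.
rewrite FE => i; have := hv i; have := hve i; have := Fv0; rewrite FE => /(_ i).
case: ifP => // _ v0i; rewrite dotpDl dotpZl v0i add0r mulNr oppr_ge0.
rewrite pmulr_rle0 // => h1 h2; apply/eqP; rewrite eq_le h1; exact: h2.
Qed.

(** A mask can be recovered from a predicate that separates the selected
    entries from the others. *)
Lemma mask_char (P : pred E) (t : bitseq) (s : seq E) : size t = size s ->
  (forall z, z \in mask t s -> P z) ->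
  (forall z, z \in mask [seq ~~ c | c <- t] s -> ~~ P z) -> t = [seq P z | z <- s].
Proof.
elim: t s => [|b t IH] [|z s] //= [st] h1 h2; congr (_ :: _).
  by case: b h1 h2 => /= h1 h2; [rewrite h1 // mem_head
                                |rewrite (negPf (h2 z _)) // mem_head].
apply: IH => // x xm; [apply: h1 | apply: h2]; case: (b) => //=;
  by rewrite inE xm orbT.
Qed.

(** A difference is tied exactly when it vanishes on the closed face. *)
Lemma closed_face_inj w w' : strip w = strip w' -> meets y [::] w -> meets y [::] w' ->
  closed_face w = closed_face w' -> w = w'.
Proof.
move=> sE mw mw' FE; apply: strip_ties_inj => //.
have dE : diffs y w = diffs y w' by rewrite -diffs_strip sE diffs_strip.
have tiesE x : meets y [::] x -> ties x =
    [seq `[< forall v, closed_face x v -> dotp v z = 0 >] | z <- diffs y x].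
  move=> /asboolP[v0 _ hv0]; apply: mask_char; first by rewrite size_ties size_diffs.
    by move=> z zt; apply/asboolP => v /andP[/allP h _]; apply/eqP/h.
  move=> z zu; apply/asboolP => /(_ v0 (on_face_closed hv0)) h0.
  by move: hv0; rewrite on_faceE => /andP[_ /allP /(_ z zu)]; rewrite h0 ltxx.
by rewrite (tiesE w) // (tiesE w') // FE dE.
Qed.

End Ties.

(** * Type B general position *)

Section TypeB.
Variables (R : realType) (d n : nat) (y : 'I_n -> 'rV[R]_d).
Notation E := 'rV[R]_d.
Notation letter := ('I_n * bool * bool)%type.
Implicit Types (a b : letter) (u w : seq letter) (v : E).

Lemma nth_diffs a u i : (i < size u)%N ->
  (diffs y u)`_i = sgv y (nth a u i) - lead y (drop i.+1 u).
Proof. by elim: u i => [|b u IH] [|i] //= li; [rewrite drop0 | exact: IH]. Qed.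

(** Enlarge A to a set of d indices. *)
Lemma free_subset (f : 'I_n -> E) : (d <= n)%N ->
  (forall A : {set 'I_n}, #|A| = d -> free [seq f i | i in A]) ->
  forall A : {set 'I_n}, (#|A| <= d)%N -> free [seq f i | i in A].
Proof.
move=> dn hf A; move: {2}(d - #|A|)%N (erefl (d - #|A|)%N) => k.
elim: k A => [|k IH] A kA Ad; first by apply: hf; apply/eqP; rewrite eqn_leq Ad -subn_eq0 kA.
have [i /= iA|h] := pickP [pred i | i \notin A]; last first.
  have cA : #|A| = n.
    by rewrite -[RHS]card_ord; apply: eq_card => i; have /negbFE -> := h i.
  by exfalso; move: kA dn; rewrite cA; lia.
have cA : #|(i |: A)%SET| = #|A|.+1 by rewrite cardsU1 iA.
have h1 : (d - #|(i |: A)%SET|)%N = k by rewrite cA; lia.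
have h2 : (#|(i |: A)%SET| <= d)%N by rewrite cA; lia.
have pe : perm_eq (enum (i |: A)%SET) (i :: enum A).
  apply: uniq_perm; rewrite ?enum_uniq //= ?mem_enum ?iA ?enum_uniq //.
  by move=> x; rewrite inE !mem_enum !inE.
by have := IH _ h1 h2; rewrite (perm_free (perm_map f pe)) free_cons => /andP[].
Qed.

(** The indices and signs of a word on all indices form a signed permutation,
    whose vectors [signed_diff] are the differences of the word. *)
Lemma typeB_gen_pos : typeB_general_position y -> gen_pos y [::] (enum 'I_n).
Proof.
move=> [dn hy] [|a0 u0] //; first by move=> _ m _; rewrite /= mask0 nil_free.
move: (a0 :: u0) => u ul m /=; rewrite add0n => sz.
have su : size u = n by rewrite -(size_map (fun a => a.1.1)) (perm_size ul) size_enum_ord.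
have uu : uniq (idx u) by rewrite (perm_uniq ul) enum_uniq.
pose f (i : 'I_n) := (nth a0 u i).1.1.
have fi : injective f.
  move=> i j; rewrite /f -!(nth_map _ a0.1.1 (fun a => a.1.1)) ?su //.
  move/eqP; rewrite (nth_uniq _ _ _ uu) ?size_map ?su // => /eqP; exact: val_inj.
pose s := perm fi; pose e (i : 'I_n) := (nth a0 u i).1.2.
have dE : diffs y u = [seq signed_diff y e s i | i <- enum 'I_n].
  apply: (@eq_from_nth _ 0); first by rewrite size_diffs size_map size_enum_ord.
  move=> i; rewrite size_diffs su => li.
  rewrite (nth_diffs a0) ?su // (nth_map (Ordinal li)) ?size_enum_ord //.
  have -> : nth (Ordinal li) (enum 'I_n) i = Ordinal li by apply: val_inj; rewrite /= nth_enum_ord.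
  rewrite /signed_diff /= permE /f /e /=.
  case: insubP => [j lj jE|/negP hi].
    have lij : (i.+1 < size u)%N by rewrite su.
    have jE' : nat_of_ord j = i.+1 by [].
    by rewrite (lead_drop _ a0 lij) permE /sgv /f jE'.
  by rewrite drop_oversize ?subr0 // su leqNgt; apply/negP.
rewrite dE -map_mask; rewrite dE -map_mask size_map in sz.
set t := mask m (enum 'I_n); have ut : uniq t by rewrite mask_uniq // enum_uniq.
have pt : perm_eq t (enum (finset (mem t))).
  by apply: uniq_perm; rewrite ?enum_uniq // => x; rewrite mem_enum inE.
rewrite (perm_free (perm_map _ pt)); apply: free_subset => // [A|].
  exact: hy.
by rewrite cardE -(perm_size pt).
Qed.

End TypeB.

(** * Chambers as connected components *)

Section Chambers.
Variables (R : realType) (d n : nat) (y : 'I_n -> 'rV[R]_d).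
Notation E := 'rV[R]_d.
Notation letter := ('I_n * bool * bool)%type.
Implicit Types (a b : letter) (u w : seq letter) (v z : E) (s : seq 'I_n).

(** The sign for which the value at v is not negative. *)
Definition letter_at v i : letter := (i, dotp v (y i) < 0, false).
Definition farther v : rel 'I_n := fun i j => `|dotp v (y j)| < `|dotp v (y i)|.

Lemma dotp_letter_at v i : dotp v (sgv y (letter_at v i)) = `|dotp v (y i)|.
Proof.
rewrite /sgv /= dotpZr; case: ltP => h; first by rewrite expr1 mulN1r ltr0_norm.
by rewrite expr0 mul1r ger0_norm.
Qed.

Lemma norm_dotp_sgv v a : `|dotp v (sgv y a)| = `|dotp v (y a.1.1)|.
Proof. by rewrite /sgv dotpZr normrM normrX normrN1 expr1n mul1r. Qed.

Lemma farther_trans v : transitive (farther v).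
Proof. by move=> j i k; rewrite /farther => h1 h2; exact: lt_trans h2 h1. Qed.

Lemma on_face_sorted v s : sorted (farther v) s ->
  all (fun i => dotp v (y i) != 0) s -> on_face y (map (letter_at v) s) v.
Proof.
elim: s => [|i s IH] //= ps /andP[i0 s0]; rewrite IH ?(path_sorted ps) // andbT.
rewrite dotpBr dotp_letter_at subr_gt0; case: s ps {IH s0} => [|j s] /=.
  by rewrite dotp0r normr_gt0.
by move=> /andP[h _]; rewrite dotp_letter_at.
Qed.

(** The values along a strict word decrease to 0, hence they are the absolute
    values of the x_i, in decreasing order; the sign of each letter is forced. *)
Lemma sorted_on_face u v : nties u = 0%N -> on_face y u v ->
  [/\ u = map (letter_at v) (idx u), sorted (farther v) (idx u) &
      all (fun i => dotp v (y i) != 0) (idx u)].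
Proof.
elim: u => [|[[i e] []] u IH] //=; rewrite /nties /= => nt /andP[h /(IH nt)[uE us u0]].
have hl : 0 <= dotp v (lead y u).
  by rewrite uE; case: (idx u) => [|j s] /=; rewrite ?dotp0r // dotp_letter_at.
move: h; rewrite dotpBr subr_gt0 => h.
have pos : 0 < dotp v (sgv y (i, e, false)) by exact: le_lt_trans h.
have eE : e = (dotp v (y i) < 0).
  move: pos; rewrite /sgv /= dotpZr; case: (e).
    by rewrite expr1 mulN1r oppr_gt0 => ->.
  by rewrite expr0 mul1r => /ltW; rewrite leNgt => /negbTE ->.
have i0 : dotp v (y i) != 0.
  by apply: contraTneq pos => h0; rewrite /sgv dotpZr h0 mulr0 ltxx.
have ie : (i, e, false) = letter_at v i by rewrite /letter_at -eE.
split; first by rewrite /= -uE -ie.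
  rewrite /= ; case: (idx u) uE us => [|j s] //= uE -> ; rewrite andbT /farther.
  by move: h; rewrite ie uE /= !dotp_letter_at.
by rewrite /= i0.
Qed.

(** Outside the arrangement the numbers |x_i| are distinct and nonzero. *)
Lemma not_arrangement v : ~ weyl_arrangement y v <->
  (forall i, dotp v (y i) != 0) /\
  (forall i j, i != j -> `|dotp v (y i)| != `|dotp v (y j)|).
Proof.
split=> [nv|[h1 h2]].
  split=> [i|i j ij]; apply/eqP => h; apply: nv.
    by right; exists i.
  have : dotp v (y i + y j) = 0 \/ dotp v (y i - y j) = 0.
    rewrite dotpBr dotpDr; move/eqP: h; rewrite eqr_norm2.
    by move=> /orP[/eqP ->|/eqP ->]; [right|left]; rewrite ?subrr ?addNr.
  have : (i < j)%N \/ (j < i)%N.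
    by apply/orP; rewrite -neq_ltn.
  move=> [lij|lji] hh; left; [exists (i, j) | exists (j, i)] => //.
  rewrite /= /perp /= [y j + _]addrC -(opprB (y i)) dotpNr.
  by case: hh => ->; [left|right; rewrite oppr0].
move=> [[[i j] /= lij] [] /= hp|[i _ hp]]; last by have := h1 i; rewrite hp eqxx.
all: have ij : i != j by rewrite -val_eqE /= neq_ltn lij.
all: have := h2 i j ij; rewrite eqr_norm2; move: hp; rewrite /perp /=.
  by rewrite dotpDr => /eqP; rewrite addr_eq0 => ->; rewrite orbT.
by rewrite dotpBr => /eqP; rewrite subr_eq0 => ->.
Qed.

Lemma pairwise_neq (T : eqType) (r : rel T) (s : seq T) i j : pairwise r s ->
  i \in s -> j \in s -> i != j -> r i j \/ r j i.
Proof.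
elim: s => [|x s IH] //= /andP[/allP h ps]; rewrite !inE.
move=> /orP[/eqP ->|si] /orP[/eqP ->|sj]; rewrite ?eqxx // => ij.
- by left; apply: h.
- by right; apply: h.
- exact: IH.
Qed.

Lemma on_face_not_arrangement u v : perm_eq (idx u) (enum 'I_n) ->
  nties u = 0%N -> on_face y u v -> ~ weyl_arrangement y v.
Proof.
move=> ul nt /(sorted_on_face nt)[_ us /allP u0]; apply/not_arrangement.
have mem i : i \in idx u by rewrite (perm_mem ul) mem_enum.
split=> [i|i j ij]; first exact: u0.
move: us; rewrite (sorted_pairwise (@farther_trans v)) => pw.
by have [h|h] := pairwise_neq pw (mem i) (mem j) ij; rewrite ?(gt_eqF h) ?(lt_eqF h).
Qed.

Lemma sorted_neq (T : eqType) (r : rel T) (s : seq T) : sorted r s -> uniq s ->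
  sorted (fun i j => r i j && (i != j)) s.
Proof.
elim: s => [|i [|j s] IH] //= /andP[rij ps] /andP[iN us].
rewrite rij; apply/andP; split; last exact: IH.
by move: iN; rewrite inE negb_or => /andP[].
Qed.

(** Sort the indices by decreasing |x_i|. *)
Lemma exists_chamber v : ~ weyl_arrangement y v ->
  exists u, [/\ perm_eq (idx u) (enum 'I_n), nties u = 0%N & on_face y u v].
Proof.
move=> /not_arrangement[h1 h2].
pose r (i j : 'I_n) := `|dotp v (y j)| <= `|dotp v (y i)|.
pose s := sort r (enum 'I_n).
have iE : idx (map (letter_at v) s) = s by rewrite /idx -map_comp map_id.
exists (map (letter_at v) s); split.
- by rewrite iE perm_sort.
- by rewrite /nties count_map; elim: (s).
apply: on_face_sorted; last by apply/allP => i _; exact: h1.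
have rs : sorted r s by apply: sort_sorted => i j; exact: le_total.
have us : uniq s by rewrite sort_uniq enum_uniq.
apply: sub_sorted (sorted_neq rs us) => i j /= /andP[rij ij].
by rewrite /farther lt_neqAle eq_sym h2 //=; exact: rij.
Qed.

(** Strictly sorted lists with the same entries are equal. *)
Lemma chamber_unique u u' v : perm_eq (idx u) (enum 'I_n) ->
  perm_eq (idx u') (enum 'I_n) -> nties u = 0%N -> nties u' = 0%N ->
  on_face y u v -> on_face y u' v -> u = u'.
Proof.
move=> ul ul' nt nt' /(sorted_on_face nt)[uE us _] /(sorted_on_face nt')[uE' us' _].
rewrite uE uE'; congr map; apply: irr_sorted_eq us us' _.
- exact: farther_trans.
- by move=> i; rewrite /farther ltxx.
- by move=> i; rewrite (perm_mem ul) (perm_mem ul').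
Qed.

Lemma diffs_not_arrangement u v : perm_eq (idx u) (enum 'I_n) ->
  ~ weyl_arrangement y v -> forall h, h \in diffs y u -> dotp v h != 0.
Proof.
move=> ul /not_arrangement[h1 h2].
have : uniq (idx u) by rewrite (perm_uniq ul) enum_uniq.
elim: u {ul} => [|a u IH] //= /andP[au uu] h; rewrite inE => /orP[/eqP ->|]; last exact: IH.
rewrite dotpBr subr_eq0; case: u au {IH uu} => [|b u] /= au.
  by rewrite dotp0r -normr_eq0 norm_dotp_sgv normr_eq0.
apply/eqP => /(congr1 Num.norm); rewrite !norm_dotp_sgv => /eqP; apply/negP/h2.
by move: au; rewrite inE negb_or => /andP[].
Qed.

Lemma dotp_continuous h : continuous (fun v : E => dotp v h).
Proof.
apply: continuous_big => [|i _]; first exact: add_continuous.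
move=> v; apply: (@continuousM _ _ (fun v : E => v 0 i) (fun=> h 0 i)).
  exact: coord_continuous.
exact: cst_continuous.
Qed.

(** Intermediate value theorem. *)
Lemma connected_same_sign (B : set E) v z h : connected B -> B v -> B z ->
  (forall x, B x -> dotp x h != 0) -> 0 < dotp v h -> 0 < dotp z h.
Proof.
move=> cB Bv Bz hB vh; rewrite ltNge; apply/negP => zh.
have cf : connected ((fun v : E => dotp v h) @` B).
  apply: connected_continuous_connected => //; apply: continuous_subspaceT.
  exact: dotp_continuous.
move/connected_intervalP: cf => /(_ (dotp z h) (dotp v h)).
have iz : [set dotp v h | v in B] (dotp z h) by exists z.
have iv : [set dotp v h | v in B] (dotp v h) by exists v.
move=> /(_ iz iv 0); rewrite zh (ltW vh) => /(_ isT)[x Bx xh].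
by have := hB x Bx; rewrite xh eqxx.
Qed.

(** The open chamber is convex, hence contained in the component.  Conversely
    no difference of u vanishes outside the arrangement, so each of them keeps
    its sign on a connected set. *)
Lemma component_chamber u v : perm_eq (idx u) (enum 'I_n) -> nties u = 0%N ->
  on_face y u v ->
  connected_component (~` weyl_arrangement y) v = [set z | on_face y u z].
Proof.
move=> ul nt uv; apply/seteqP; split=> [z [B [Bv BA cB] Bz] /=|z /= uz].
  rewrite on_face_strict //; apply/allP => h hu /=.
  apply: (connected_same_sign cB Bv Bz) => [x /BA xA|].
    exact: (diffs_not_arrangement ul xA).
  by move: uv; rewrite on_face_strict // => /allP; exact.
pose f (t : R) : E := v + t *: (z - v).
have cf : connected (f @` `[0, 1]%classic).
  apply: connected_continuous_connected; first exact: segment_connected.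
  apply: continuous_subspaceT => t; apply: cvgD; first exact: cvg_cst.
  exact: scalel_continuous.
apply: (connected_component_max _ _ cf).
- by exists 0; rewrite /f ?scale0r ?addr0 //= in_itv /= lexx ler01.
- move=> _ [t + <-]; rewrite /= in_itv /= => /andP[t0 t1].
  apply: (on_face_not_arrangement ul nt).
  move: uv uz; rewrite !on_face_strict // => /allP hv /allP hz.
  apply/allP => h hu /=; rewrite /f dotpDl dotpZl dotpBl.
  have := hv h hu; have := hz h hu => /= a b.
  rewrite -(subrK 1 t).
  have -> : dotp v h + (t - 1 + 1) * (dotp z h - dotp v h) =
     (1 - t) * dotp v h + t * dotp z h by ring.
  have [t0'|t0'] := eqVneq t 0; first by rewrite t0' subr0 mul1r mul0r addr0.
  by rewrite ltr_wpDl ?mulr_ge0 ?mulr_gt0 // ?subr_ge0 ?(ltW b) // lt_def t0'.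
- by exists 1; rewrite /f ?scale1r ?subrKC //= in_itv /= lexx ler01.
Qed.

Lemma closed_closed_face w : closed (closed_face y w).
Proof.
rewrite (_ : closed_face y w = \bigcap_(z in [set` tied y w]) [set v | dotp v z = 0]
  `&` \bigcap_(z in [set` untied y w]) [set v | 0 <= dotp v z]); last first.
  apply/seteqP; split=> [v /andP[/allP h1 /allP h2]|v [h1 h2]].
    by split=> z /=; [move=> /h1 /eqP | exact: h2].
  by apply/andP; split; apply/allP => z zw; [apply/eqP; exact: h1 | exact: h2].
apply: closedI; apply: closed_bigI => z _.
  apply: (@closed_comp _ _ (fun v : E => dotp v z) [set x | x = 0]).
    by move=> v _; exact: dotp_continuous.
  exact: closed_eq.
apply: (@closed_comp _ _ (fun v : E => dotp v z) [set x | 0 <= x]).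
  by move=> v _; exact: dotp_continuous.
exact: closed_ge.
Qed.

(** Adding a small multiple of an interior point moves the points of the closed
    cone to its interior. *)
Lemma closure_chamber u v0 : nties u = 0%N -> on_face y u v0 ->
  closure [set z | on_face y u z] = closed_face y u.
Proof.
move=> nt uv0; apply/seteqP; split.
  rewrite [X in _ `<=` X](_ : _ = closure (closed_face y u)); last first.
    exact/closure_id/closed_closed_face.
  by apply: closureS => z; exact: on_face_closed.
move=> v; rewrite closed_cone // => /allP hv B /nbhs_ballP[e /= e0 he].
pose t := e / 2 / (`|v0| + 1).
have N1 : 0 < `|v0| + 1 by rewrite ltr_wpDl.
have t0 : 0 < t by rewrite !divr_gt0.
exists (v + t *: v0); split=> /=.
  rewrite on_face_strict //; apply/allP => h hu /=; rewrite dotpDl dotpZl.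
  rewrite ltr_wpDl ?mulr_gt0 ?hv //.
  by move: uv0; rewrite on_face_strict // => /allP; exact.
apply: he; rewrite -ball_normE /= opprD addrA subrr add0r normrN normrZ gtr0_norm //.
rewrite /t; apply: (@le_lt_trans _ _ (e / 2)); last by rewrite ltr_pdivrMr // ltr_pMr // ltr1n.
rewrite mulrAC ler_pdivrMr // ler_wpM2l ?lerDl //.
by rewrite divr_ge0 // ltW.
Qed.

End Chambers.

(** * Integrals and sums *)

Section AeConstant.
Local Open Scope ereal_scope.
Import HBNNSimple.

(** This also covers functions f that are not measurable.  The integral is the
    supremum of the integrals of the simple functions below f.  Such a function
    is at most c almost everywhere, and the function equal to c on a measurable
    set of full measure is one of them. *)
Lemma integral_ae_cst (disp : measure_display) (T : measurableType disp)
    (R : realType) (P : probability T R) (f : T -> \bar R) (c : R) :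
  (forall x, 0 <= f x) -> {ae P, forall x, f x = c%:E} -> \int[P]_x f x = c%:E.
Proof.
move=> f0 fc; have [N [mN PN fN]] := fc.
have out x : ~ N x -> f x = c%:E by apply: contra_notP => h; exact: fN.
have c0 : (0 <= c)%R.
  have [x nx] : exists x, ~ N x.
    apply: contrapT => h; have : P setT = 0.
      rewrite -PN; congr (P _); apply/seteqP; split=> // x _.
      by apply: contrapT => nx; apply: h; exists x.
    by rewrite probability_setT => /eqP; rewrite onee_eq0.
  by rewrite -lee_fin -(out x nx).
apply/eqP; rewrite eq_le; apply/andP; split.
  rewrite ge0_integralTE //; apply: ge_ereal_sup => _ [h /= hf <-].
  have -> : sintegral P h = \int[P]_x (h x)%:E.
    by rewrite integral_nnsfun // patch_setT.
  apply: (@le_trans _ _ (\int[P]_x (cst c%:E x))).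
    apply: ae_ge0_le_integral => //.
    - by move=> x _; rewrite lee_fin.
    - by apply/measurable_EFinP.
    - apply: filterS fc => x fx _ /=; rewrite -fx; exact: hf.
  by rewrite integral_cst // [X in _ * X](_ : _ = 1) ?mule1 //; exact: probability_setT.
have mN' : measurable (~` N) by exact: measurableC.
(* The simple function that is c off N and 0 on N. *)
pose h := scale_nnsfun (indic_nnsfun R mN') c0.
have hE x : h x = (c * \1_(~` N) x)%R by [].
apply: (@le_trans _ _ (\int[P]_x (h x)%:E)).
  under eq_integral do rewrite hE EFinM.
  have mI : measurable_fun setT (fun x : T => (\1_(~` N) x : R)%:E).
    by apply/measurable_EFinP; exact: measurable_indic.
  have I0 (x : T) : [set: T] x -> 0 <= (\1_(~` N) x : R)%:E by rewrite lee_fin.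
  rewrite (ge0_integralZl P measurableT mI I0) ?lee_fin //.
  rewrite integral_indic // setIT [X in _ * X](_ : _ = 1) ?mule1 //.
  have := probability_setC P mN; rewrite PN sube0; exact.
rewrite integral_nnsfun // patch_setT ge0_integralTE //.
have hf x : (h x)%:E <= f x.
  rewrite hE indicE; case: (boolP (x \in ~` N)) => /= [|_]; last by rewrite mulr0.
  by rewrite inE => /out ->; rewrite mulr1.
by apply: ereal_sup_ubound; exists h.
Qed.

End AeConstant.

Section FiniteImage.

Lemma fsum_image (T : finType) (U : choiceType) (V : zmodType) (Q : pred T)
    (f : T -> U) (F : U -> V) : {in Q &, injective f} ->
  \sum_(C \in f @` [set` Q]) F C = \sum_(u | Q u) F (f u).
Proof.
move=> fi; rewrite fsbig_image; last by move=> u v; rewrite !mem_setE; exact: fi.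
rewrite -(@bigfs _ _ _ _ (index_enum T)) ?index_enum_uniq // => i _.
by rewrite mem_index_enum.
Qed.

Lemma card_image (R : numDomainType) (T : finType) (U : choiceType) (Q : pred T) (f : T -> U) :
  {in Q &, injective f} ->
  (#|` fset_set (f @` [set` Q])|%:R : R) = \sum_(u | Q u) 1.
Proof.
move=> fi; rewrite -(fsum_image (fun=> 1) fi) fsbig_finite.
  by rewrite card_fset_sum1 natr_sum.
by apply: finite_image; exact: finite_finset.
Qed.

End FiniteImage.

(** * Cones and faces of the tessellation *)

Section Tessellation.
Variables (R : realType) (d n : nat) (y : 'I_n -> 'rV[R]_d).
Notation E := 'rV[R]_d.
Notation letter := ('I_n * bool * bool)%type.
Notation l := (enum 'I_n).
Implicit Types (v z : E).
Hypothesis gp : gen_pos y [::] l.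
Hypothesis dn : (d <= n)%N.

Definition is_word r : pred (n.-tuple letter) := fun u => perm_eq (idx u) l && (nties u == r).

(** The faces of the tessellation, each with a cone to which it belongs. *)
Definition realized r : pred (n.-tuple letter) := fun u => is_word r u && meets y [::] u.

Lemma face_count_card H r :
  (face_count y H n l r =
   \sum_(u : n.-tuple letter | is_word r u && meets y H u) 1)%N.
Proof.
rewrite /face_count [RHS]big_mkcondr; apply: eq_bigr => u _.
by case: meets.
Qed.

Lemma map_implb (P : pred E) (t : bitseq) (s : seq E) : size t = size s ->
  (forall z, z \in mask t s -> P z) -> all2 implb t [seq P z | z <- s].
Proof.
elim: t s => [|c t IH] [|z s] //= [st] h; rewrite IH //; last first.
  by move=> x xm; apply: h; case: (c) => //; rewrite inE xm orbT.
by rewrite andbT; case: c h => //= -> //; rewrite mem_head.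
Qed.

(** A face of codimension at most d is in the closure of the chamber of its
    word. *)
Lemma meets_strip r (u : n.-tuple letter) : (r <= d)%N -> realized r u ->
  meets y [::] (strip u).
Proof.
move=> rd /andP[/andP[ul /eqP nt] mu].
apply: (untie gp (u := strip u) _ _ _ _ mu).
- by rewrite idx_strip.
- by rewrite /ties -map_comp; elim: (tval u) => //= -[[i e] t] s ->.
- by rewrite strip_id // nties_strip.
- by rewrite add0n nt.
Qed.

Lemma tessellationE :
  weyl_tessellation y = [set closed_face y (val u) | u in [set` realized 0]].
Proof.
apply/seteqP; split=> [_ [v nv <-]|_ [u + <-]].
  have [u [ul nt uv]] := exists_chamber nv.
  have su : size u == n by rewrite -(size_map (fun a => a.1.1)) (perm_size ul) size_enum_ord.
  exists (Tuple su); first by apply/andP; split; [apply/andP; rewrite nt | apply/asboolP; exists v].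
  by rewrite (component_chamber ul nt uv) (closure_chamber nt uv).
move=> /= /andP[/andP[ul /eqP nt] /asboolP[v _ uv]]; exists v.
  exact: (on_face_not_arrangement ul nt uv).
by rewrite (component_chamber ul nt uv) (closure_chamber nt uv).
Qed.

(** A point of the open chamber of u that lies in the closed cone of u' is off
    the arrangement, hence in the open chamber of u'. *)
Lemma closed_chamber_inj :
  {in realized 0 &, injective (fun u : n.-tuple letter => closed_face y (val u))}.
Proof.
move=> u u' /andP[/andP[ul /eqP nt] /asboolP[v _ uv]] /andP[/andP[ul' /eqP nt'] _] /= uu.
apply: val_inj => /=; apply: (chamber_unique ul ul' nt nt' uv).
have : closed_face y u' v by rewrite -uu; exact: on_face_closed.
rewrite closed_cone // on_face_strict // => /allP h; apply/allP => z zu /=.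
rewrite lt_def h // andbT.
exact: (diffs_not_arrangement ul' (on_face_not_arrangement ul nt uv) zu).
Qed.

(** The faces of a cone are closed faces of words with the same chamber, and
    the dimension determines the number of ties. *)
Lemma facesE r (u : n.-tuple letter) : (r < d)%N -> realized 0 u ->
  faces (d - r) (closed_face y u) =
  [set closed_face y (val w) | w in
    [set` [pred w : n.-tuple letter | realized r w & strip w == u]]].
Proof.
move=> rd /andP[/andP[ul /eqP nt] mu]; apply/seteqP; split=> [F [fF dF]|_ [w + <-]].
  have [w [wu FE mw]] := is_face_closed_face nt fF.
  have wl : perm_eq (idx w) l by rewrite -idx_strip wu.
  have sw : size w == n by rewrite -(size_map (fun a => (a.1, false))) -/(strip w) wu size_tuple.
  have := has_dim_closed_face gp wl mw; rewrite -FE => /(has_dim_inj dF) dE.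
  exists (Tuple sw) => //; apply/andP; split; last exact/eqP.
  by apply/andP; split=> //; apply/andP; split=> //=; lia.
move=> /= /andP[/andP[/andP[wl /eqP wt] mw] /eqP wu]; split.
  exact: closed_face_is_face.
by rewrite -wt; exact: (has_dim_closed_face gp wl).
Qed.

(** A word with ties belongs to exactly one cone, that of its chamber. *)
Lemma sum_faces r (V : zmodType) (F : set E -> V) : (r < d)%N ->
  \sum_(C \in weyl_tessellation y) \sum_(D \in faces (d - r) C) F D =
  \sum_(w : n.-tuple letter | realized r w) F (closed_face y (val w)).
Proof.
move=> rd; rewrite tessellationE (fsum_image _ closed_chamber_inj).
transitivity (\sum_(u : n.-tuple letter | realized 0 u)
    \sum_(w : n.-tuple letter | realized r w && (strip w == u)) F (closed_face y (val w))).
  apply: eq_bigr => u ru; rewrite (facesE rd ru) fsum_image //.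
  move=> w w' /andP[/andP[_ mw] /eqP wu] /andP[/andP[_ mw'] /eqP wu'] h.
  by apply: val_inj; apply: (closed_face_inj _ mw mw' h); rewrite wu wu'.
rewrite (exchange_big_dep (realized r)) /=; last by move=> u w _ /andP[].
apply: eq_bigr => w rw; have /andP[/andP[wl /eqP nw] mw] := rw.
have sw : size (strip w) == n by rewrite size_map size_tuple.
rewrite (big_pred1 (Tuple sw)) // => u; rewrite rw /= eq_sym.
apply/andP/eqP => [[_ /eqP uw]|->]; first exact: val_inj.
rewrite eqxx; split=> //; rewrite /realized /is_word /= idx_strip wl nties_strip eqxx.
exact: (meets_strip (ltnW rd) rw).
Qed.

Lemma card_tessellation : (1 <= n)%N ->
  (#|` fset_set (weyl_tessellation y)|%:R : R) = (DB n d)%:~R.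
Proof.
move=> n0; rewrite tessellationE (card_image _ closed_chamber_inj).
have ln : size l = n.-1.+1 by rewrite size_enum_ord prednK.
have := chamber_count (enum_uniq 'I_n) ln gp (leq0n d).
rewrite prednK // subn0 => <-; rewrite face_count_card /realized.
by rewrite -pmulrn natr_sum.
Qed.

(** A nonzero vector of L in the closed face realizes a word w' with at least
    the ties of w.  There are at most dim L ties in w', since dim L independent
    equations only leave 0 in L; so [untie] moves the vector inside L to the
    relatively open face of w. *)
Lemma face_hits L w r : gen_pos y (normals L) l -> perm_eq (idx w) l -> nties w = r ->
  (r < \dim L)%N ->
  (closed_face y w `&` [set` L] <> [set 0]) <-> meets y (normals L) w.
Proof.
move=> gL wl nt rL; have sL := size_normals L; split; last first.
  move=> /asboolP[v vL wv] h.
  have : (closed_face y w `&` [set` L]) v.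
    by split; [exact: on_face_closed | rewrite /= -orth_normals].
  rewrite h => /= v0; move: wv; rewrite v0 on_faceE => /andP[_].
  have : (0 < size (untied y w))%N.
    rewrite /untied size_mask ?size_map ?size_ties ?size_diffs //.
    have := count_predC id (ties w); rewrite -nties_count nt size_ties.
    rewrite count_map /= (_ : size w = n); last first.
      by rewrite -(size_map (fun a => a.1.1)) (perm_size wl) size_enum_ord.
    have := dim_rV_le L; rewrite /preim /predC /=; lia.
  by case: (untied y w) => //= z s _; rewrite dotp0l ltxx.
move=> hne; have [v [Fv vL v0]] : exists v, [/\ closed_face y w v, v \in L & v != 0].
  apply: contrapT => h; apply: hne; apply/seteqP; split=> [v [Fv vL] /=|_ ->].
    by apply: contrapT => /eqP v0; apply: h; exists v.
  split; last exact: mem0v.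
  by apply/andP; split; apply/allP => z _; rewrite /= dotp0l.
pose w' := retie w (map (fun z => dotp v z == 0) (diffs y w)).
have szt : size (map (fun z => dotp v z == 0) (diffs y w)) = size w by rewrite size_map size_diffs.
have sE : strip w' = strip w by rewrite strip_retie.
have dE : diffs y w' = diffs y w by rewrite -diffs_strip sE diffs_strip.
have wl' : perm_eq (idx w') l by rewrite -idx_strip sE idx_strip.
have tE : tied y w' = seq.filter (fun z => dotp v z == 0) (diffs y w).
  by rewrite /tied ties_retie // dE filter_mask.
have uE : untied y w' = seq.filter (fun z => dotp v z != 0) (diffs y w).
  by rewrite /untied ties_retie // dE filter_mask -map_comp.
have on' : on_face y w' v.
  rewrite on_faceE tE uE; apply/andP; split; apply/allP => z; rewrite mem_filter => /andP[h zd] //.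
  by rewrite /= lt_def h (allP (closed_face_sub Fv)).
have vnL : orth (normals L) v by rewrite orth_normals.
apply: (untie gL wl (w := w')) => //; last by apply/asboolP; exists v.
  rewrite ties_retie // map_implb ?size_ties ?size_diffs // => z zt.
  by have /andP[/allP h _] := Fv; exact: h.
rewrite leqNgt; apply/negP => big.
(* dim L of these equations would leave only the vector 0 in L. *)
have /subseqP[m _ mE] : subseq (take (\dim L) (tied y w')) (diffs y w').
  by apply: subseq_trans (take_subseq _ _) (mask_subseq _ _).
have st : size (take (\dim L) (tied y w')) = \dim L.
  rewrite size_takel // size_tied; lia.
have fr : free (normals L ++ take (\dim L) (tied y w')).
  by rewrite mE; apply: (gL w' wl'); rewrite -mE st addnC sL.
have : v = 0; last by move=> h; rewrite h eqxx in v0.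
apply: (orth_full fr); first by rewrite size_cat st addnC.
rewrite /orth all_cat -!/(orth _ _) vnL /=; apply/allP => z /mem_take.
by rewrite tE mem_filter => /andP[].
Qed.

Lemma realized_hits L r : gen_pos y (normals L) l -> (r < \dim L)%N ->
  (\sum_(w : n.-tuple letter | realized r w) \1_[set w : n.-tuple letter |
      closed_face y (val w) `&` [set` L] <> [set 0]] w : R) =
  (face_count y (normals L) n l r)%:R.
Proof.
move=> gL rL; rewrite face_count_card natr_sum [LHS]big_mkcond [RHS]big_mkcond.
apply: eq_bigr => w _; rewrite /realized.
case: (boolP (is_word r w)) => //= /andP[wl /eqP nt].
have hh := face_hits gL wl nt rL.
case: (boolP (meets y (normals L) w)) => [ml|nml].
  rewrite (_ : meets y [::] w); last first.
    by move: ml => /asboolP[v _ wv]; apply/asboolP; exists v.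
  by rewrite indicE mem_set //=; apply/hh.
rewrite indicE memNset /=; last by move=> /hh; apply/negP.
by case: ifP.
Qed.

End Tessellation.

(** * The average over the tessellation *)

Section Average.
Variables (R : realType) (d n : nat) (y : 'I_n -> 'rV[R]_d).
Notation E := 'rV[R]_d.
Notation letter := ('I_n * bool * bool)%type.
Notation l := (enum 'I_n).
Hypothesis gp : gen_pos y [::] l.
Hypothesis dn : (d <= n)%N.
Variable nu : forall m : 'I_d.+1, probability (borel_grass R m) R.
Hypothesis nu_inv : forall m : 'I_d.+1, rotation_invariant (nu m).

(** Only the countably many subspaces orthogonal to sets of differences have to
    be avoided. *)
Lemma gen_pos_ae (m : 'I_d.+1) :
  {ae nu m, forall L, gen_pos y (normals (val L)) l}.
Proof.
pose F (k : nat) : set (borel_grass R m) :=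
  if (choice.unpickle k : option (seq letter * bitseq)) is Some c
  then special (perpv (mask c.2 (diffs y c.1))) else set0.
have nF k : (nu m).-negligible (F k).
  rewrite /F; case: choice.unpickle => [c|]; last exact: negligible_set0.
  exists (special (perpv (mask c.2 (diffs y c.1)))); split=> //.
    exact: measurable_special.
  exact: nu_special.
apply: negligibleS (negligible_bigcup nF) => L hL.
apply: contrapT => nL; apply: hL; apply: (gen_pos_generic gp) => u ul c.
apply: contrapT => sL; apply: nL.
by exists (choice.pickle (u, c)) => //; rewrite /F choice.pickleK.
Qed.

(** The number of pairs of a cone of the tessellation and a face of codimension
    r of it that meets a generic k-dimensional subspace beyond 0. *)
Definition met_faces (r k : nat) : R :=
  2 ^+ r * 'C(n, r)%:R * (DB (n - r) (k - r))%:~R * (n`!%:R / (n - r)`!%:R).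

Lemma face_count_generic (m : 'I_d.+1) (L : borel_grass R m) r : (r < m)%N ->
  gen_pos y (normals (val L)) l ->
  (face_count y (normals (val L)) n l r)%:R = met_faces r m.
Proof.
move=> rm gL; have sL := size_normals (val L); rewrite dim_grass in sL.
have md : (m <= d)%N by rewrite -ltnS.
have sN : size (normals (val L)) = (d - m)%N by lia.
have rn : (r < n)%N by lia.
have := face_count_formula (enum_uniq 'I_n) (size_enum_ord n) gL rn _.
rewrite sN => /(_ _)/(congr1 (fun z : int => z%:~R : R)) h.
have sr : (d - m + r < d)%N by lia.
have {}h := h sr.
have f0 : ((n - r)`!%:R : R) != 0 by rewrite pnatr_eq0 -lt0n fact_gt0.
apply: (mulIf f0); rewrite -natrM /met_faces.
move: h; rewrite -[LHS]pmulrn => ->; rewrite intrM -pmulrn.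
rewrite !natrM natrX (_ : (d - (d - m) - r = m - r)%N); last by lia.
by field.
Qed.

Definition hits (m : 'I_d.+1) (F : set E) : set (borel_grass R m) :=
  [set L : borel_grass R m | F `&` [set` val L] <> [set 0]].

Lemma measurable_hits_face (m : 'I_d.+1) w : measurable (@hits m (closed_face y w)).
Proof.
apply: measurable_hits; first exact: closed_closed_face.
  by apply/andP; split; apply/allP => z _; rewrite /= dotp0l.
move=> c v c0 /andP[/allP h1 /allP h2]; apply/andP; split; apply/allP => z zw.
  by rewrite /= dotpZl (eqP (h1 z zw)) mulr0.
by rewrite /= dotpZl mulr_ge0 ?(ltW c0) //; exact: h2.
Qed.

(** The sum is the integral of the number of faces that meet L, which is
    constant for almost every L. *)
Lemma sum_hits (m : 'I_d.+1) r : (r < m)%N ->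
  \sum_(w : n.-tuple letter | realized y r w)
    fine (nu m (@hits m (closed_face y (val w)))) =
  met_faces r m.
Proof.
move=> rm.
have mh w : measurable (@hits m (closed_face y w)) by exact: measurable_hits_face.
apply: EFin_inj; rewrite -sumEFin.
have I0 (w : n.-tuple letter) (L : borel_grass R m) :
    [set: borel_grass R m] L -> (0 <= (\1_(@hits m (closed_face y (val w))) L : R)%:E)%E.
  by rewrite lee_fin.
have mI (w : n.-tuple letter) :
    measurable_fun setT (fun L : borel_grass R m => (\1_(@hits m (closed_face y (val w))) L : R)%:E).
  by apply/measurable_EFinP; exact: measurable_indic.
transitivity (\sum_(w <- [seq w <- index_enum _ | realized y r w])
    (\int[nu m]_L (\1_(@hits m (closed_face y (val w))) L)%:E))%E.
  rewrite big_filter; apply: eq_bigr => w _.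
  rewrite integral_indic // setIT fineK //; exact: fin_num_measure.
rewrite -(ge0_integral_sum (nu m) measurableT mI I0).
apply: integral_ae_cst => [L|].
  by apply: sume_ge0 => w _; exact: I0.
apply: negligibleS (gen_pos_ae m); apply: subsetC => L gL.
rewrite /= sumEFin big_filter; congr (_%:E); rewrite -(face_count_generic rm gL).
rewrite -(realized_hits _ gL) ?dim_grass //.
Qed.

(** The factor 1/2 in the quermassintegrals explains the factor 2 in the
    denominator; the number of cones is [DB n d]. *)
Theorem weyl_average j k : (1 <= j <= k)%N -> (k <= d)%N ->
  let W := weyl_tessellation y in
  (#|` fset_set W|%:R)^-1 * \sum_(C \in W) size_functional nu (d - k + j) (d - k) C =
  (2 ^+ (k - j) * 'C(n, k - j)%:R * (DB (n - k + j) j)%:~R)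
     / (2 * (DB n d)%:~R) * (n`!%:R / (n - k + j)`!%:R).
Proof.
move=> /andP[j1 jk] kd W; rewrite /W.
have -> : (d - k + j = d - (k - j))%N by lia.
have rd : (k - j < d)%N by lia.
rewrite (sum_faces gp dn _ rd) card_tessellation //; last by lia.
rewrite /quermass /Rintegral.
set K : 'I_d.+1 := inord _.
have KE : K = k :> nat by rewrite inordK; lia.
rewrite -big_distrr /=.
have -> : \sum_(w : n.-tuple letter | realized y (k - j)%N w)
    fine (\int[nu K]_L (\1_(@hits K (closed_face y (val w))) L)%:E)%E
   = met_faces (k - j) k.
  rewrite -[in RHS]KE -sum_hits ?KE; last by lia.
  apply: eq_bigr => w _; rewrite integral_indic ?setIT //.
  exact: measurable_hits_face.
rewrite /met_faces.
have -> : (k - (k - j) = j)%N by lia.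
have -> : (n - (k - j) = n - k + j)%N by lia.
by rewrite invfM; ring.
Qed.

End Average.

(** * Expected size functionals of the Weyl random cone *)

Theorem theorem1p8 (R : realType) (disp : measure_display)
    (T : measurableType disp) (P : probability T R)
    (d n : nat) (Y : 'I_n -> {RV P >-> borel_rV R d})
    (nu : forall m : 'I_d.+1, probability (borel_grass R m) R)
    (j k : nat) :
  (2 <= d)%N ->
  {ae P, forall w, typeB_general_position (fun i => Y i w : 'rV[R]_d)} ->
  (forall m : 'I_d.+1, rotation_invariant (nu m)) ->
  (1 <= j <= k)%N -> (k <= d)%N ->
  weyl_cone_expectation Y (size_functional nu (d - k + j) (d - k)) =
  ((2 ^+ (k - j) * 'C(n, k - j)%:R * (DB (n - k + j) j)%:~R)
     / (2 * (DB n d)%:~R)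
   * (n`!%:R / (n - k + j)`!%:R))%:E.
Proof.
move=> _ gpY nu_inv jk kd; rewrite /weyl_cone_expectation unlock.
apply: integral_ae_cst => [w|].
  rewrite lee_fin mulr_ge0 ?invr_ge0 //; apply: fsumr_ge0 => C _.
  apply: fsumr_ge0 => F _; rewrite mulr_ge0 ?invr_ge0 //.
  by apply: Rintegral_ge0.
apply: negligibleS gpY; apply: subsetC => w /= gw; congr (_%:E).
have [dn _] := gw.
exact: (weyl_average (typeB_gen_pos gw) dn nu_inv jk kd).
Qed.
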